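(* Let $L$ be an even lattice of signature $(n,2)$, $V=L_{\mathbb{Q}}$, let $I\subseteq L$ be a primitive isotropic sublattice of rank 2, let $U=I_{\mathbb{Q}}$, and let $\Upsilon$ be the corresponding 1-dimensional Baily--Borel cusp. Then the quotient $\overline{\Gamma}_{L,I}\backslash\widetilde{\mathcal{D}}(\Upsilon)$, and with it the generic subset of the toroidal boundary divisor associated with the cusp $\Upsilon$, is isomorphic to $\Gamma_{\Lambda} \backslash W_{L^{*}}^{\Lambda,b}$.
   Context: **Lattices and groups.** $(\cdot,\cdot)$ is the bilinear form on $V$; $L$ even means $(\lambda,\lambda)\in2\mathbb{Z}$ for $\lambda\in L$. $L^*=\{\nu\in V:(\nu,L)\subseteq\mathbb{Z}\}$. $W=U^\perp/U$ (positive definite here), $I=U\cap L$, $I_{L^*}=U\cap L^*$, $\Lambda=(U^\perp\cap L)/I\subseteq W$ is an even lattice with dual $\Lambda^*=(U^\perp\cap L^* )/I_{L^*}\subseteq W$, $\Delta_\Lambda=\Lambda^*/\Lambda$. $\mathcal{P}_U$ is the stabilizer of $U$ in $\mathrm{O}(V)$; $\mathcal{P}^0_{U_{\mathbb{R}}}$ is the identity component of $\mathcal{P}_{U_{\mathbb{R}}}$; $\Gamma_L$ is the group of automorphisms of $L$ lying in the identity component $\mathrm{SO}^+(V_{\mathbb{R}})$ of $\mathrm{O}(V_{\mathbb{R}})$ and acting trivially on $L^*/L$; $\Gamma_\Lambda$ is defined similarly (a finite group); $\Gamma_{L,I}=\mathcal{P}^0_{U_{\mathbb{R}}}\cap\Gamma_L$.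 The elements of $\mathcal{P}_U$ acting trivially on $U^\perp$ are the maps $v\mapsto v-\eta v^*$ with $\eta\in\mathrm{Hom}^{as}_{\mathbb{Q}}(U^*,U)$ (maps $\eta$ such that $(u^*,v^* )\mapsto(u^*,\eta v^* )$ is anti-symmetric), where $v^*\in U^*$ is pairing with $v$; $\overline{\mathcal{P}}_U=\mathcal{P}_U/\mathrm{Hom}^{as}_{\mathbb{Q}}(U^*,U)$ acts on $V/U$, and $\overline\Gamma_{L,I}$ is the image of $\Gamma_{L,I}$ in $\overline{\mathcal{P}}_U$. $\mathrm{SL}(I_{L^*},I)=\{M\in\mathrm{SL}(I):u-Mu\in I\ \forall u\in I_{L^*}\}$. Fix a $\mathbb{Z}$-basis $(z,w)$ of $I$; the image of $\mathrm{SL}(I_{L^*},I)$ in $\mathrm{SL}_2(\mathbb{Z})$ is denoted $\Gamma_{L^*}$. **The spaces.** $\mathcal{H}$ is the upper half-plane. The symmetric space of $\mathrm{O}(V_{\mathbb{R}})$ is $G(V_{\mathbb{R}})=\{v_-\subseteq V_{\mathbb{R}}\text{ negative definite},\dim v_-=2\}\cong\{Z_V\in V_{\mathbb{C}}:Z_V^2=0,\ (Z_V,\overline{Z}_V)<0,\ (Z_V,z)=1,\ (\Re Z_V,\Im Z_V)\text{ oriented}\}$, with the orientation chosen so that $\tau:=(Z_V,w)\in\mathcal{H}$. Put $$\widetilde{\mathcal{D}}(\Upsilon)=\bigcup_{\tau\in\mathcal{H}}W^{1,\tau}_{\mathbb{C}},\qquad W^{1,\tau}_{\mathbb{C}}=\{\xi\in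 V_{\mathbb{C}}:(\xi,z)=1,\ (\xi,w)=\tau\}/U_{\mathbb{C}},$$ a holomorphic affine vector bundle over $\mathcal{H}$, on which $\overline\Gamma_{L,I}$ acts by $\xi\mapsto A\xi/(A\xi,z)$. Reduction modulo $U_{\mathbb{C}}$ makes $G(V_{\mathbb{R}})$ a bundle over $\widetilde{\mathcal{D}}(\Upsilon)$ whose fibers are translated upper half-planes, on which $\mathcal{U}_{\mathbb{Z}}(\Upsilon)=\mathrm{Hom}^{as}(I^*,I)\cong\mathbb{Z}$ acts by integral translations, so $\mathcal{U}_{\mathbb{Z}}(\Upsilon)\backslash G(V_{\mathbb{R}})$ is a punctured disc bundle over $\widetilde{\mathcal{D}}(\Upsilon)$. The generic subset of the toroidal boundary divisor associated with $\Upsilon$ (the canonical toroidal boundary component over $\Upsilon$) is obtained by filling in the zero section of this bundle and taking the image of that zero section modulo $\Gamma_{L,I}$. **The map $\iota^*$ and the cocycle $b$.** Choose a sublattice $\tilde I\subseteq L^*$ whose pairing with $I$ is unimodular (i.e. it induces an isomorphism $\tilde I\cong\mathrm{Hom}(I,\mathbb{Z})$), let $(\zeta,\upsilon)$ be the basis of $\tilde I$ dual to $(z,w)$, $\tilde U=\tilde I_{\mathbb{Q}}$, $\tilde W=(U\oplus\tilde U)^\perp\cong W$, so $V=U\oplus\tilde W\oplus\tilde U$, and let $\tilde\Lambda\subseteq\tilde\Lambda^*\subseteq\tilde W$ correspond to $\Lambda\subseteq\Lambda^*$. Put $\tilde I_L=\{\mu\in\tilde I:\exists\nu\in L\ \forall\lambda\in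 I,\ (\mu,\lambda)=(\nu,\lambda)\}$, which pairs unimodularly with $I_{L^*}$, so that $\mathrm{Hom}(\tilde I_L,\mathbb{Q}/\mathbb{Z})\cong U/I_{L^*}$. There is a unique homomorphism $\iota:\tilde I_L\to\Delta_\Lambda$ such that whenever $u+x+\tilde u\in L$ with $u\in U$, $x\in\tilde W$, $\tilde u\in\tilde U$, one has $\tilde u\in\tilde I_L$, $x\in\tilde\Lambda^*$ and $x+\tilde\Lambda=\iota\tilde u$. Its dual is $\iota^*:\Delta_\Lambda\to U/I_{L^*}$, $(\iota^*\delta,\tilde u)=(\delta,\iota\tilde u)\in\mathbb{Q}/\mathbb{Z}$. For $M\in\mathrm{SL}(I_{L^*},I)$ put $b_M=(\mathrm{Id}_U-M)\circ\iota^*\in\mathrm{Hom}(\Delta_\Lambda,U/I)$, where $\mathrm{Id}_U-M:U/I_{L^*}\to U/I$; it satisfies $b_{MN}=b_M+M\circ b_N$. Via the basis $(z,w)$ and the pairing on $\Delta_\Lambda$, $b_M$ is identified with a pair $(\lambda_M,\mu_M)\in\Delta_\Lambda\times\Delta_\Lambda$, where $b_M(\delta)=(\lambda_M,\delta)z+(\mu_M,\delta)w$ in $U/I\cong(\mathbb{Q}/\mathbb{Z})^2$. **The Kuga--Sato type variety.** $\mathcal{E}\to\mathcal{H}$ is the universal elliptic curve with fiber $E_\tau=\mathbb{C}/(\mathbb{Z}\oplus\mathbb{Z}\tau)$, and $\mathcal{E}\otimes\Lambda\to\mathcal{H}$ has fiber $E_\tau\otimes\Lambda=\Lambda_{\mathbb{C}}/(\Lambda\oplus\Lambda\tau)$,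 which contains $\Delta_\Lambda\oplus\Delta_\Lambda\tau$. $W_{L^*}^{\Lambda,b}$ is the quotient of $\mathcal{E}\otimes\Lambda$ by the action of $\Gamma_{L^*}$ in which $M$, in addition to its natural action, acts on the fibers by translation by the image of $b_M$ in $\Delta_\Lambda\oplus\Delta_\Lambda\tau$. Explicitly, for $M\in\mathrm{SL}(I_{L^*},I)$ let $M^{-*}$ be the action on $\tilde U\cong U^*$ defined by $(M^{-*}\tilde u,u)=(\tilde u,M^{-1}u)$, put $j(M,\tau)=(M^{-*}(\zeta+\tau\upsilon),z)$ and define $M\tau$ by $M^{-*}(\zeta+\tau\upsilon)=j(M,\tau)(\zeta+(M\tau)\upsilon)$; then $M$ sends $(\tau,x)$, $x\in E_\tau\otimes\Lambda$, to $\big(M\tau,\ j(M,\tau)^{-1}x+\lambda_M+\mu_M\cdot(M\tau)\big)$. The group $\Gamma_\Lambda$ acts on the fibers through its action on $\Lambda_{\mathbb{C}}=W_{\mathbb{C}}$; since it acts trivially on $\Delta_\Lambda$, this action descends to $W_{L^*}^{\Lambda,b}$, and $\Gamma_\Lambda\backslash W_{L^*}^{\Lambda,b}$ is the resulting quotient (its structure sheaf being given by invariant functions). *)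

(* Defs.v *)
From HB Require Import structures.
From mathcomp Require Import all_boot all_order all_algebra.
From mathcomp Require Import all_classical all_reals all_analysis.
From mathcomp Require Import generic_quotient complex.
From Stdlib Require Relations.Relation_Operators.

Set Implicit Arguments.
Unset Strict Implicit.
Unset Printing Implicit Defensive.

Import Order.TTheory GRing.Theory Num.Theory.
Import numFieldNormedType.Exports.

Local Open Scope classical_set_scope.
Local Open Scope ring_scope.
Local Open Scope quotient_scope.

(* Reduced complex analytic spaces, as topological spaces with a structure
   sheaf of complex-valued functions.  [fholo O f] says that f is a section
   over the open set O; the values of f outside O play no role. *)
Record fspace (R : realType) := FSpace {
  fpt :> topologicalType ;
  fholo : set fpt -> (fpt -> R[i]) -> Prop }.

(* A finite-dimensional complex vector space. *)
Definition fvect (R : realType) (E : normedModType R[i]) : fspace R :=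
  @FSpace R E (fun O f => forall p, O p -> differentiable (f : E -> R[i]^o) p).

(* Sections over a subset are, locally, restrictions of ambient sections. *)
Definition fsub (R : realType) (X : fspace R) (A : set X) : fspace R :=
  @FSpace R (set_type A) (fun O f => forall p : set_type A, O p ->
    exists N g, [/\ open N, N (set_val p), @fholo R X N g &
      forall q : set_type A, N (set_val q) -> O q -> f q = g (set_val q)]).

Section Quotient.
Context (T : choiceType) (r : T -> T -> Prop).

Definition gen_eqv : rel T :=
  fun x y => `[< Relation_Operators.clos_refl_sym_trans T r x y >].

Lemma gen_eqv_refl : reflexive gen_eqv.
Proof. by move=> x; apply/asboolP/Relation_Operators.rst_refl. Qed.

Lemma gen_eqv_sym : symmetric gen_eqv.
Proof.
by move=> x y; apply/asboolP/asboolP; exact: Relation_Operators.rst_sym.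
Qed.

Lemma gen_eqv_trans : transitive gen_eqv.
Proof.
move=> y x t /asboolP xy /asboolP yt; apply/asboolP.
exact: Relation_Operators.rst_trans xy yt.
Qed.

Definition gen_equiv : equiv_rel T :=
  EquivRel gen_eqv gen_eqv_refl gen_eqv_sym gen_eqv_trans.

End Quotient.

(* The quotient of X by the equivalence relation generated by r (in all uses
   below r relates a point to its translates under a group), with the quotient
   topology; its sections are the r-invariant sections of X. *)
Definition fquo (R : realType) (X : fspace R) (r : X -> X -> Prop) : fspace R :=
  @FSpace R (quotient_topology {eq_quot (gen_equiv r)})
    (fun O f => @fholo R X [set x | O (\pi_{eq_quot (gen_equiv r)}%qT x)]
                           (fun x => f (\pi_{eq_quot (gen_equiv r)}%qT x))).

Definition fproj (R : realType) (X : fspace R) (r : X -> X -> Prop) :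
  X -> fquo r := fun x => \pi_{eq_quot (gen_equiv r)}%qT x.

Definition pushrel (X Y : Type) (f : X -> Y) (r : X -> X -> Prop) :
  Y -> Y -> Prop := fun p q => exists x y, [/\ p = f x, q = f y & r x y].

Definition fiso (R : realType) (X Y : fspace R) : Prop :=
  exists (f : X -> Y) (g : Y -> X),
    [/\ cancel f g, cancel g f, continuous f, continuous g &
        forall (O : set Y) (h : Y -> R[i]), open O ->
          (fholo O h <-> @fholo R X (f @^-1` O) (h \o f))].

(* A lattice of rank N is Z^N with the bilinear form of Gram matrix G, and
   V_K = K^N (column vectors) for K the rationals, the reals or R[i]. *)
Definition ofint (K : pzRingType) (p q : nat) (A : 'M[int]_(p, q)) :
  'M[K]_(p, q) := map_mx intr A.

Definition bilform (K : comPzRingType) (N : nat) (G : 'M[int]_N)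
  (x y : 'cV[K]_N) : K := (x^T *m ofint K G *m y) 0 0.

Definition even_lattice (N : nat) (G : 'M[int]_N) : Prop :=
  G^T = G /\ forall x : 'cV[int]_N, (2 %| bilform G x x)%Z.

Definition has_signature (R : realType) (N : nat) (G : 'M[int]_N)
  (p q : nat) : Prop :=
  (p + q)%N = N /\
  exists2 S : 'M[R]_N, S \in unitmx &
    S^T *m ofint R G *m S = diag_mx (\row_(i < N) if (i < p)%N then 1 else -1).

Definition lat (N : nat) : set 'cV[rat]_N :=
  [set ofint rat x | x in [set: 'cV[int]_N]].

Definition dual_lat (N : nat) (G : 'M[int]_N) : set 'cV[rat]_N :=
  [set v | forall x, lat x -> bilform G v x \is a Num.int].

Definition Zbasis (N : nat) (I : set 'cV[int]_N) (z w : 'cV[int]_N) : Prop :=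
  I = [set a *: z + b *: w | a in [set: int] & b in [set: int]] /\
  forall a b : int, a *: z + b *: w = 0 -> a = 0 /\ b = 0.

Definition isotropic_sublattice (N : nat) (G : 'M[int]_N) (I : set 'cV[int]_N) : Prop :=
  forall x y, I x -> I y -> bilform G x y = 0.

Definition primitive_sublattice (N : nat) (I : set 'cV[int]_N) : Prop :=
  forall (k : int) x, k != 0 -> I (k *: x) -> I x.

(* The columns of B lie in the orthogonal complement of U, and their classes
   form a Z-basis of Lambda, the quotient by I of the lattice of vectors of L
   orthogonal to I.  Lambda is then the lattice Z^m with Gram matrix
   B^T G B, and c in Q^m is the class of B c in W. *)
Definition Lambda_basis (N m : nat) (G : 'M[int]_N) (I : set 'cV[int]_N)
  (B : 'M[int]_(N, m)) : Prop :=
  (forall (c : 'cV[int]_m) y, I y -> bilform G (B *m c) y = 0) /\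
  forall x : 'cV[int]_N, (forall y, I y -> bilform G x y = 0) ->
    exists! c : 'cV[int]_m, I (x - B *m c).

Definition gramLambda (N m : nat) (G : 'M[int]_N) (B : 'M[int]_(N, m)) :
  'M[int]_m := B^T *m G *m B.

Definition orthogonal_group (R : realType) (N : nat) (G : 'M[int]_N) :
  set 'M[R]_N := [set A | A^T *m ofint R G *m A = ofint R G].

Definition SOplus (R : realType) (N : nat) (G : 'M[int]_N) : set 'M[R]_N :=
  connected_component (@orthogonal_group R N G) 1%:M.

(* The group denoted Gamma_L for L, and Gamma_Lambda for Lambda. *)
Definition disc_kernel (R : realType) (N : nat) (G : 'M[int]_N) :
  set 'M[int]_N :=
  [set A | [/\ A \in unitmx, SOplus G (ofint R A) &
     forall v, dual_lat G v -> lat (ofint rat A *m v - v)]].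

Section Cusp.
Context (R : realType) (N m : nat) (G : 'M[int]_N) (z w : 'cV[int]_N)
  (zeta ups : 'cV[rat]_N) (B : 'M[int]_(N, m)).

Local Notation C := (R[i]).

Definition basU : 'M[int]_(N, 2) := row_mx z w.

Definition spaceU (K : pzRingType) : set 'cV[K]_N :=
  [set ofint K basU *m c | c in [set: 'cV[K]_2]].
Arguments spaceU : clear implicits.

Definition latI : set 'cV[rat]_N :=
  [set ofint rat (basU *m c) | c in [set: 'cV[int]_2]].

Definition parabolic : set 'M[R]_N :=
  [set A | orthogonal_group G A /\ mulmx A @` spaceU R = spaceU R].

Definition GammaLI : set 'M[int]_N :=
  [set A | connected_component parabolic 1%:M (ofint R A) /\ disc_kernel R G A].

(* S is the matrix of eta in Hom(U^*, U) for the basis of U^* dual to (z, w)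
   and the basis (z, w) of U; eta is in Hom^as iff S is antisymmetric. *)
Definition antisym_mx (K : pzRingType) : set 'M[K]_2 := [set S | S^T = - S].
Arguments antisym_mx : clear implicits.

(* The map v |-> v - eta v^*. *)
Definition unip (K : pzRingType) (S : 'M[K]_2) : 'M[K]_N :=
  1%:M - ofint K basU *m S *m (ofint K basU)^T *m ofint K G.

(* The image of Gamma_{L,I} in P_U / Hom^as(U^*, U), as a set of cosets. *)
Definition GammaLI_bar : set (set 'M[rat]_N) :=
  [set [set ofint rat A *m unip S | S in antisym_mx rat] | A in GammaLI].

(* xi |-> A xi / (A xi, z) *)
Definition pact (A : 'M[C]_N) (xi : 'cV[C]_N) : 'cV[C]_N :=
  (bilform G (A *m xi) (ofint C z))^-1 *: (A *m xi).

Definition Dhat : set (fvect 'cV[C]_N) :=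
  [set xi : 'cV[C]_N | bilform G xi (ofint C z) = 1 /\
     0 < complex.Im (bilform G xi (ofint C w))].

Definition Dtilde : fspace R :=
  fquo (X := fsub Dhat) (fun p q => spaceU C (set_val q - set_val p)).

Definition Dtilde_quo : fspace R :=
  fquo (X := Dtilde) (pushrel (@fproj R (fsub Dhat) _) (fun p q =>
    exists2 A : 'M[rat]_N, (exists2 cA, GammaLI_bar cA & cA A) &
      set_val q = pact (map_mx ratr A) (set_val p))).

(* e(s) = exp(2 pi i s) *)
Definition expi2pi (s : C) : C :=
  ((expR (- (2 * trigo.pi * complex.Im s)) * cos (2 * trigo.pi * complex.Re s)) +i*
   (expR (- (2 * trigo.pi * complex.Im s)) * sin (2 * trigo.pi * complex.Re s)))%C.

(* U_C . G(V_R), the ambient principal bundle over Dtilde with structure group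
   Hom^as(U_C^*, U_C), which acts through [unip]. *)
Definition Ghat : set 'cV[C]_N :=
  [set Z | [/\ bilform G Z Z = 0, bilform G Z (ofint C z) = 1 &
     0 < complex.Im (bilform G Z (ofint C w))]].

(* G(V_R), as the set of the normalized oriented Z_V. *)
Definition GV : set 'cV[C]_N :=
  [set Z | Ghat Z /\ bilform G Z (map_mx conjc Z) < 0].

(* The filled disc bundle.  Hom^as(U_C^*, U_C) is identified with C by
   s = S 1 0, so that Hom^as(I^*, I) is Z, and for Z in Ghat the fiber
   { s | unip S Z in GV } is a translated upper half-plane.  A point of the
   disc bundle over the class of Z is [Z, t], subject to
   [unip S Z, t] = [Z, e(s) t]: this is the line bundle associated with the
   principal C^*-bundle Hom^as(I^*, I)\Ghat.  The points [Z, 1] with Z in GV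
   form the punctured disc bundle Hom^as(I^*, I)\GV, and t -> 0 as
   Im s -> +oo, so that { [Z, 0] } is the zero section filled in. *)
Definition disc_set : set (fvect ('cV[C]_N * C^o)%type) :=
  [set p : ('cV[C]_N * C^o)%type | Ghat p.1 /\
    (p.2 = 0 \/ exists S, [/\ antisym_mx C S, GV (unip S *m p.1) &
                              p.2 = expi2pi (S 1 0)])].

Definition disc_bundle : fspace R :=
  fquo (X := fsub disc_set) (fun p q => exists S, [/\ antisym_mx C S,
    (set_val q).1 = unip S *m (set_val p).1 &
    (set_val p).2 = expi2pi (S 1 0) * (set_val q).2]).

(* For A in Gamma_{L,I} and s as above, A commutes with [unip S] up to the
   normalization in [pact], hence acts by [Z, t] |-> [A Z / (A Z, z), t]. *)
Definition disc_bundle_quo : fspace R :=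
  fquo (X := disc_bundle) (pushrel (@fproj R (fsub disc_set) _) (fun p q =>
    exists2 A, GammaLI A &
      (set_val q).1 = pact (ofint C A) (set_val p).1 /\
      (set_val q).2 = (set_val p).2)).

Definition toroidal_boundary : fspace R :=
  fsub (X := disc_bundle_quo)
    [set b | exists2 p : fsub disc_set, (set_val p).2 = 0 &
       b = @fproj R disc_bundle _ (@fproj R (fsub disc_set) _ p)].

(* M : 'M_2 is the matrix of an automorphism of I in the basis (z, w). *)
Definition SLI : set 'M[int]_2 :=
  [set M | \det M = 1 /\
     forall c : 'cV[rat]_2, dual_lat G (ofint rat basU *m c) ->
       latI (ofint rat basU *m (c - ofint rat M *m c))].

(* (zeta, ups) is dual to (z, w), so M^{-*} has matrix (M^{-1})^T in the basis
   (zeta, ups); this is M^{-*}(zeta + tau ups) in that basis. *)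
Definition Mdual (M : 'M[int]_2) (tau : C) : 'cV[C]_2 :=
  ofint C (invmx M)^T *m (\col_(i < 2) if i == 0 then 1 else tau).

Definition jM (M : 'M[int]_2) (tau : C) : C := Mdual M tau 0 0.

Definition Mtau (M : 'M[int]_2) (tau : C) : C := Mdual M tau 1 0 / jM M tau.

Definition tilI : set 'cV[rat]_N :=
  [set a%:~R *: zeta + b%:~R *: ups | a in [set: int] & b in [set: int]].

Definition tilIL : set 'cV[rat]_N :=
  [set mu | tilI mu /\ exists2 nu, lat nu &
     forall l, latI l -> bilform G mu l = bilform G nu l].

Definition tilW : set 'cV[rat]_N :=
  [set x | [/\ bilform G x (ofint rat z) = 0, bilform G x (ofint rat w) = 0,
     bilform G x zeta = 0 & bilform G x ups = 0]].

(* Homomorphisms into quotient groups are given by their graphs, on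
   representatives. *)

(* c represents the class iota(ut); the middle term x is the lift of c to tilW. *)
Definition iota_rel (ut : 'cV[rat]_N) (c : 'cV[rat]_m) : Prop :=
  tilIL ut /\ exists u x, [/\ spaceU rat u, tilW x,
    spaceU rat (x - ofint rat B *m c) & lat (u + x + ut)].

(* c in Q^2 is the coordinate vector, modulo I_{L^*}, of iota^* delta. *)
Definition iota_star (delta : 'cV[rat]_m) (c : 'cV[rat]_2) : Prop :=
  forall ut d, iota_rel ut d ->
    bilform G (ofint rat basU *m c) ut - bilform (gramLambda G B) delta d
      \is a Num.int.

(* v represents b_M(delta) in U/I. *)
Definition bM (M : 'M[int]_2) (delta : 'cV[rat]_m) (v : 'cV[rat]_N) : Prop :=
  exists2 c, iota_star delta c &
    latI (v - ofint rat basU *m (c - ofint rat M *m c)).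

(* (lam, mu) represents (lambda_M, mu_M). *)
Definition bM_pair (M : 'M[int]_2) (lam mu : 'cV[rat]_m) : Prop :=
  [/\ dual_lat (gramLambda G B) lam, dual_lat (gramLambda G B) mu &
   forall delta, dual_lat (gramLambda G B) delta ->
     bM M delta (bilform (gramLambda G B) lam delta *: ofint rat z +
                 bilform (gramLambda G B) mu delta *: ofint rat w)].

(* The pairs (tau, x) with x in Lambda_C = C^m. *)
Definition HLambda : set (fvect (C^o * 'cV[C]_m)%type) :=
  [set p : (C^o * 'cV[C]_m)%type | 0 < complex.Im p.1].

Definition ELambda : fspace R :=
  fquo (X := fsub HLambda) (fun p q =>
    (set_val q).1 = (set_val p).1 /\
    exists l l' : 'cV[int]_m,
      (set_val q).2 =
        (set_val p).2 + (ofint C l + ((set_val p).1 : C) *: ofint C l')).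

Definition WLb : fspace R :=
  fquo (X := ELambda) (pushrel (@fproj R (fsub HLambda) _) (fun p q =>
    exists M lam mu, [/\ SLI M, bM_pair M lam mu,
      (set_val q).1 = Mtau M (set_val p).1 &
      (set_val q).2 = (jM M (set_val p).1)^-1 *: (set_val p).2 +
        (map_mx ratr lam + Mtau M (set_val p).1 *: map_mx ratr mu)])).

Definition WLb_quo : fspace R :=
  fquo (X := WLb)
    (pushrel (fun p => @fproj R ELambda _ (@fproj R (fsub HLambda) _ p))
      (fun p q => exists2 g, disc_kernel R (gramLambda G B) g &
        (set_val q).1 = (set_val p).1 /\
        (set_val q).2 = ofint C g *m (set_val p).2)).

End Cusp.

(* Main.v *)
Require Import Defs.
From HB Require Import structures.
From mathcomp Require Import all_boot all_order all_algebra.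
From mathcomp Require Import all_classical all_reals all_analysis.
From mathcomp Require Import generic_quotient complex ring.
From Stdlib Require Relations.Relation_Operators.

Set Implicit Arguments.
Unset Strict Implicit.
Unset Printing Implicit Defensive.

Import Order.TTheory GRing.Theory Num.Theory.
Import numFieldNormedType.Exports.

Local Open Scope classical_set_scope.
Local Open Scope ring_scope.

(* Split V into U, a lift of W and a complement of U dual to U.  Modulo U_C, a
   point xi of the affine bundle is determined by tau = (xi, w) and by the
   component in W_C of xi - zeta - tau ups, so the bundle is identified with
   the product of the upper half-plane and Lambda_C by an affine map, and only
   the group actions have to be compared.  An element A of Gamma_{L,I} acts on
   V/U through its action M on I, its action on Lambda, and an off-diagonal
   block.  Triviality of A on the vectors of L^* orthogonal to U says that M is
   in SL(I_{L^*}, I), that A acts on Lambda through Gamma_Lambda, and that the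
   off-diagonal block represents b_M.  Conversely, M and a representative of
   b_M leave only the U-component of the images of zeta and ups to be chosen:
   orthogonality prescribes its symmetric part, and an integral choice exists
   because L is even.  Scaling the off-diagonal data along a path in SL_2(R)
   shows that the result is in the identity component.  Translations by
   Lambda + Lambda tau are the case M = 1.  Finally, two isotropic lifts of a
   point of the affine bundle differ by an element of Hom^as(U_C^*, U_C), so
   that the zero section of the disc bundle has the same quotient. *)

(** * Morphisms of function spaces *)

(** The link between triviality on L^* and b_M is one identity. The vectors of L^* orthogonal to U
    are those of the form v = [Bt *m d - P *m a] where a represents iota^* d. If A P = P M and A Bt
    = P H + Bt c, then A v - v has U-component H d + (a - M a), which must be integral.
    Orthogonality gives H = - X^T g c for the translation block X, and c d - d is integral, so X^T g
    d represents b_M(d). In the converse direction the obstacle is integrality. The vectors zeta and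
    ups lie in L^* but in general not in L, and their span need not be isotropic, so a constructed
    isometry cannot be seen to be integral on a basis of V adapted to the frame. Instead the
    displacement A v - v is shown to be integral for every v in L^*, which gives integrality of A
    and triviality on L^*/L at once. The quotients are compared through the generating relations
    alone: each generator on one side is realized by one or two on the other, so the group extension
    formed by the image of Gamma_{L,I} is never described. *)

Section FunctionSpaces.
Context {R : realType}.
Implicit Types X Y Z : fspace R.

Lemma open_preimage (S T : topologicalType) (f : S -> T) (O : set T) :
  continuous f -> open O -> open (f @^-1` O).
Proof. by move/continuousP; exact. Qed.

Definition fmor X Y (f : X -> Y) : Prop :=
  continuous f /\ forall (O : set Y) h, open O -> fholo O h ->
    @fholo R X (f @^-1` O) (h \o f).

Lemma fmor_comp X Y Z (f : X -> Y) (g : Y -> Z) :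
  fmor f -> fmor g -> fmor (g \o f).
Proof.
move=> [cf hf] [cg hg]; split; first by move=> x; apply: continuous_comp; [exact: cf|exact: cg].
move=> O h oO hO; rewrite comp_preimage; apply: (hf _ (h \o g)).
  exact: (open_preimage cg).
exact: hg.
Qed.

Lemma fiso_of_fmor X Y (f : X -> Y) (g : Y -> X) :
  cancel f g -> cancel g f -> fmor f -> fmor g -> fiso X Y.
Proof.
move=> fK gK [cf hf] [cg hg]; exists f, g; split=> // O h oO; split.
  exact: hf.
move=> hO; have := hg _ _ _ hO.
have -> : g @^-1` (f @^-1` O) = O.
  by apply/predeqP=> y; rewrite /preimage /= gK.
have -> : (h \o f) \o g = h by apply/funext=> y /=; rewrite gK.
by apply; exact: (open_preimage cf).
Qed.

Lemma fproj_fmor X (r : X -> X -> Prop) : fmor (fproj r).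
Proof.
split; first exact: pi_continuous.
by move=> O h oO.
Qed.

Lemma fproj_surj X (r : X -> X -> Prop) (q : fquo r) : exists x, q = fproj r x.
Proof. by exists (repr q); rewrite /fproj reprK. Qed.

Lemma fproj_eqE X (r : X -> X -> Prop) x y :
  (fproj r x = fproj r y) <-> gen_eqv r x y.
Proof.
by split=> [/(eqmodP (gen_equiv r))|/(eqmodP (gen_equiv r))].
Qed.

Lemma fproj_eq X (r : X -> X -> Prop) x y : r x y -> fproj r x = fproj r y.
Proof.
move=> rxy; apply/fproj_eqE.
by apply/asboolP; apply: Relation_Operators.rst_step.
Qed.

Lemma fproj_inv X (r : X -> X -> Prop) T (f : X -> T) :
  (forall x y, r x y -> f x = f y) ->
  forall x y, fproj r x = fproj r y -> f x = f y.
Proof.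
move=> fr x y /fproj_eqE/asboolP.
elim=> {x y} [x y /fr //|//|x y _ -> //|x y z _ -> _ -> //].
Qed.

(** Universal property of the quotient. A section of a quotient is by definition a function whose
    pullback is a section, so only continuity of the induced map has to be argued. *)
Lemma fquo_lift X Y (r : X -> X -> Prop) (f : X -> Y) : fmor f ->
  (forall x y, r x y -> f x = f y) ->
  exists2 g : fquo r -> Y, fmor g & forall x, g (fproj r x) = f x.
Proof.
move=> [cf hf] fr; pose g (q : fquo r) := f (repr q).
have gE x : g (fproj r x) = f x by apply: (fproj_inv fr); rewrite /fproj reprK.
have gE' : g \o fproj r = f by apply/funext=> x; exact: gE.
exists g => //; split.
  by apply/quotient_continuous; rewrite -[X in continuous X]/(g \o fproj r) gE'.
move=> O h oO /(hf _ _ oO); rewrite -gE' => hO.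
exact: hO.
Qed.

Lemma fsub_val_fmor X (A : set X) : fmor (set_val : fsub A -> X).
Proof.
split; first exact: initial_continuous.
by move=> O h oO hO p Op; exists O, h; split.
Qed.

(** The gluing axiom, which is not built into [fspace]. It is required of the source of a map into
    an [fsub], because sections there are restrictions of ambient sections only locally. *)
Definition flocal X : Prop := forall (O : set X) h, open O ->
  (forall p, O p -> exists N g,
    [/\ open N, N p, @fholo R X N g & forall q, N q -> O q -> h q = g q]) ->
  fholo O h.

Lemma continuous_fsub X (T : topologicalType) (A : set X) (f : T -> fsub A) :
  continuous (set_val \o f) -> continuous f.
Proof. by move=> cf; apply: (continuous_comp_initial). Qed.

Lemma fmor_fsub X Y (A : set Y) (f : X -> fsub A) :
  flocal X -> fmor (set_val \o f : X -> Y) -> fmor f.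
Proof.
move=> lX [cf hf]; have cf' : continuous f by exact: continuous_fsub.
split=> // O h oO hO; apply: lX.
  exact: (open_preimage cf').
move=> p Op; have [N [g [oN Np hN gh]]] := hO _ Op.
exists ((set_val \o f) @^-1` N), (g \o (set_val \o f)); split=> //.
- exact: (open_preimage cf).
- exact: hf.
- by move=> q Nq Oq; exact: gh.
Qed.

Lemma flocal_fsub_fvect (E : normedModType R[i]) (A : set (fvect E)) :
  flocal (fsub A).
Proof.
move=> O h oO H p Op; have [N [g [[V oV VN] Np hN gh]]] := H _ Op.
have [N' [g' [oN' N'p hN' gg']]] := hN _ Np.
(* The neighbourhood [N] is open only in the subspace; it is the trace of the ambient open set [V],
   to which [N'] is cut down. *)
exists (N' `&` V), g'; split=> //.
- exact: openI.
- by split=> //; move: Np; rewrite -VN.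
- by move=> x [N'x _]; exact: hN'.
move=> q [N'q Vq] Oq; have Nq : N q by rewrite -VN.
by rewrite gh// gg'.
Qed.

Lemma fmor_fvect (E E' : normedModType R[i]) (f : E -> E') :
  (forall x, differentiable f x) -> fmor (f : fvect E -> fvect E').
Proof.
move=> df; split; first by move=> x; exact: differentiable_continuous.
by move=> O h oO hO p Op; apply: differentiable_comp => //; exact: hO.
Qed.

End FunctionSpaces.

(** * Frames *)

Lemma mxD_entry (K : nmodType) p q (A B : 'M[K]_(p, q)) i j :
  (A + B) i j = A i j + B i j.
Proof. by rewrite mxE. Qed.

Lemma mxN_entry (K : zmodType) p q (A : 'M[K]_(p, q)) i j :
  (- A) i j = - A i j.
Proof. by rewrite mxE. Qed.

(* Decides identities of abelian groups between matrices, the products being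
   atoms. *)
Ltac mxabel := apply/matrixP => ? ?; rewrite ?(mxD_entry, mxN_entry); ring.

Section Frames.

(* The decomposition of V adapted to the filtration of V by U and its
   orthogonal: the columns of [P] span U, those of [B] a lift of W, and those
   of [Z] a complement (not necessarily isotropic) dual to [P]. *)
Record frame (K : fieldType) (N m : nat) (G : 'M[K]_N) (P : 'M[K]_(N, 2))
  (B : 'M[K]_(N, m)) (Z : 'M[K]_(N, 2)) : Prop := Frame {
  frame_sym : G^T = G ;
  frame_PP : P^T *m G *m P = 0 ;
  frame_PB : P^T *m G *m B = 0 ;
  frame_ZP : Z^T *m G *m P = 1%:M ;
  frame_ZB : Z^T *m G *m B = 0 ;
  frame_BB : B^T *m G *m B \in unitmx ;
  frame_span : forall v : 'cV[K]_N, P^T *m G *m v = 0 ->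
    exists a b, v = P *m a + B *m b }.

Section Coordinates.
Context (K : fieldType) (N m : nat) (G : 'M[K]_N) (P : 'M[K]_(N, 2))
  (B : 'M[K]_(N, m)) (Z : 'M[K]_(N, 2)).

(** The three coordinate maps of the frame. The second term of [coP] removes the contribution of the
    Gram matrix of [Z], which vanishes only when the complement is isotropic. *)
Definition coP := Z^T *m G - Z^T *m G *m Z *m (P^T *m G).
Definition coB := invmx (B^T *m G *m B) *m (B^T *m G).
Definition coZ := P^T *m G.

Hypothesis fr : frame G P B Z.

Lemma frame_tr p q (A : 'M[K]_(N, p)) (C : 'M[K]_(N, q)) :
  (A^T *m G *m C)^T = C^T *m G *m A.
Proof. by rewrite !trmx_mul trmxK (frame_sym fr) mulmxA. Qed.

Lemma frame_BP : B^T *m G *m P = 0.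
Proof.
by rewrite -frame_tr (frame_PB fr) trmx0.
Qed.

Lemma frame_PZ : P^T *m G *m Z = 1%:M.
Proof.
by rewrite -frame_tr (frame_ZP fr) trmx1.
Qed.

Lemma frame_BZ : B^T *m G *m Z = 0.
Proof.
by rewrite -frame_tr (frame_ZB fr) trmx0.
Qed.

Lemma coPP : coP *m P = 1%:M.
Proof.
by rewrite mulmxBl (frame_ZP fr) -[X in _ - X]mulmxA (frame_PP fr) mulmx0 subr0.
Qed.

Lemma coPB : coP *m B = 0.
Proof.
by rewrite mulmxBl (frame_ZB fr) -[X in _ - X]mulmxA (frame_PB fr) mulmx0 subr0.
Qed.

Lemma coPZ : coP *m Z = 0.
Proof.
by rewrite mulmxBl -[X in _ - X]mulmxA frame_PZ mulmx1 subrr.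
Qed.

Lemma coBP : coB *m P = 0.
Proof. by rewrite -mulmxA frame_BP mulmx0. Qed.

Lemma coBB : coB *m B = 1%:M.
Proof. by rewrite -mulmxA mulVmx// (frame_BB fr). Qed.

Lemma coBZ : coB *m Z = 0.
Proof. by rewrite -mulmxA frame_BZ mulmx0. Qed.

Lemma coZP : coZ *m P = 0. Proof. exact: (frame_PP fr). Qed.
Lemma coZB : coZ *m B = 0. Proof. exact: (frame_PB fr). Qed.
Lemma coZZ : coZ *m Z = 1%:M. Proof. exact: frame_PZ. Qed.

Lemma frame_dec q (v : 'M[K]_(N, q)) :
  v = P *m (coP *m v) + B *m (coB *m v) + Z *m (coZ *m v).
Proof.
have dec (u : 'cV[K]_N) : u = P *m (coP *m u) + B *m (coB *m u) + Z *m (coZ *m u).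
  have [|a [b]] := frame_span fr (v := u - Z *m (coZ *m u)).
    by rewrite mulmxBr [X in _ - X](mulmxA _ Z) frame_PZ mul1mx subrr.
  move: (coZ *m u) => t /(canRL (subrK _)) ->; rewrite ?addrA.
  rewrite !mulmxDr !(mulmxA coP) !(mulmxA coB).
  rewrite coPP coPB coPZ coBP coBB coBZ.
  by rewrite !(mul1mx, mul0mx, mulmx0, addr0, add0r).
apply/matrixP => i j; suff: col j v =
    col j (P *m (coP *m v) + B *m (coB *m v) + Z *m (coZ *m v)).
  by move/matrixP/(_ i 0); rewrite ![col _ _ _ _]mxE.
by rewrite !colE 2!mulmxDl {1}[v *m _]dec !mulmxA.
Qed.

Lemma coP_comb q (a : 'M[K]_(2, q)) (b : 'M[K]_(m, q)) :
  coP *m (P *m a + B *m b) = a.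
Proof.
by rewrite mulmxDr (mulmxA coP P) (mulmxA coP B) coPP coPB mul1mx mul0mx addr0.
Qed.

Lemma coB_comb q (a : 'M[K]_(2, q)) (b : 'M[K]_(m, q)) :
  coB *m (P *m a + B *m b) = b.
Proof.
by rewrite mulmxDr (mulmxA coB P) (mulmxA coB B) coBP coBB mul1mx mul0mx add0r.
Qed.

Lemma frame_ext q (X Y : 'M[K]_(q, N)) :
  X *m P = Y *m P -> X *m B = Y *m B -> X *m Z = Y *m Z -> X = Y.
Proof.
move=> eP eB eZ; rewrite -[X]mulmx1 -[Y]mulmx1 (frame_dec 1%:M).
by rewrite !mulmxDr !mulmxA eP eB eZ.
Qed.

Lemma frame_ext_tr q (X Y : 'M[K]_(N, q)) :
  P^T *m X = P^T *m Y -> B^T *m X = B^T *m Y -> Z^T *m X = Z^T *m Y -> X = Y.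
Proof.
move=> eP eB eZ; apply: trmx_inj; apply: frame_ext; apply: trmx_inj;
  by rewrite !trmx_mul !trmxK.
Qed.

(** The general endomorphism preserving the flag formed by U and its orthogonal, in block triangular
    form: the columns of the block matrix are the images of [P], [B] and [Z]. *)
Definition elt (M : 'M[K]_2) (c : 'M[K]_m) (D : 'M[K]_2) (H : 'M[K]_(2, m))
    (X : 'M[K]_(m, 2)) (J : 'M[K]_2) : 'M[K]_N :=
  P *m M *m coP + (P *m H + B *m c) *m coB + (P *m J + B *m X + Z *m D) *m coZ.

Section Elt.
Context (M : 'M[K]_2) (c : 'M[K]_m) (D : 'M[K]_2) (H : 'M[K]_(2, m))
    (X : 'M[K]_(m, 2)) (J : 'M[K]_2).

Lemma elt_P : elt M c D H X J *m P = P *m M.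
Proof.
by rewrite 2!mulmxDl -(mulmxA _ coP) -(mulmxA _ coB) -(mulmxA _ coZ)
  coPP coBP coZP !(mulmx0, mulmx1, addr0).
Qed.

Lemma elt_B : elt M c D H X J *m B = P *m H + B *m c.
Proof.
by rewrite 2!mulmxDl -(mulmxA _ coP) -(mulmxA _ coB) -(mulmxA _ coZ)
  coPB coBB coZB !(mulmx0, mulmx1, addr0, add0r).
Qed.

Lemma elt_Z : elt M c D H X J *m Z = P *m J + B *m X + Z *m D.
Proof.
by rewrite 2!mulmxDl -(mulmxA _ coP) -(mulmxA _ coB) -(mulmxA _ coZ)
  coPZ coBZ coZZ !(mulmx0, mulmx1, addr0, add0r).
Qed.

End Elt.

Lemma form_coord p q r t (A : 'M[K]_(N, p)) (C : 'M[K]_(N, q)) (a : 'M[K]_(p, r))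
    (b : 'M[K]_(q, t)) :
  (A *m a)^T *m G *m (C *m b) = a^T *m (A^T *m G *m C) *m b.
Proof. by rewrite trmx_mul !mulmxA. Qed.

Lemma frame_form p q (a : 'M[K]_(2, p)) (b : 'M[K]_(m, p)) (d : 'M[K]_(2, p))
    (a' : 'M[K]_(2, q)) (b' : 'M[K]_(m, q)) (d' : 'M[K]_(2, q)) :
  (P *m a + B *m b + Z *m d)^T *m G *m (P *m a' + B *m b' + Z *m d') =
  a^T *m d' + b^T *m (B^T *m G *m B) *m b' + d^T *m a' +
  d^T *m (Z^T *m G *m Z) *m d'.
Proof.
rewrite !linearD /= !(mulmxDl, mulmxDr) !form_coord.
rewrite (frame_PP fr) (frame_PB fr) (frame_ZP fr) (frame_ZB fr).
rewrite frame_PZ frame_BP frame_BZ.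
by rewrite !(mulmx0, mul0mx, mulmx1, addr0, add0r); mxabel.
Qed.

Local Notation g := (B^T *m G *m B).
Local Notation T := (Z^T *m G *m Z).

Section Isometry.
Context (A : 'M[K]_N) (M : 'M[K]_2) (c : 'M[K]_m) (D : 'M[K]_2)
  (H : 'M[K]_(2, m)) (X : 'M[K]_(m, 2)) (J : 'M[K]_2).
Hypotheses (AP : A *m P = P *m M) (AB : A *m B = P *m H + B *m c)
  (AZ : A *m Z = P *m J + B *m X + Z *m D).

(** Being an isometry is tested on the Gram matrix of the images of the frame. By symmetry six of
    its nine blocks suffice; the last hypothesis is the block of [Z] with itself, the only one that
    involves [J]. *)
Lemma isometry_of_blocks :
  M^T *m D = 1%:M -> c^T *m g *m c = g -> D^T *m H + X^T *m g *m c = 0 ->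
  J^T *m D + X^T *m g *m X + D^T *m J + D^T *m T *m D = T ->
  A^T *m G *m A = G.
Proof.
move=> MD cg HX JT.
have DM : D^T *m M = 1%:M by rewrite -[LHS]trmxK trmx_mul trmxK MD trmx1.
have AP' : A *m P = P *m M + B *m 0 + Z *m 0 by rewrite !mulmx0 !addr0.
have AB' : A *m B = P *m H + B *m c + Z *m 0 by rewrite !mulmx0 !addr0.
have E p q (C : 'M[K]_(N, p)) (C' : 'M[K]_(N, q)) :
  C^T *m (A^T *m G *m A *m C') = (A *m C)^T *m G *m (A *m C').
  by rewrite trmx_mul !mulmxA.
have S p q (C : 'M[K]_(N, p)) (C' : 'M[K]_(N, q)) :
  (A *m C')^T *m G *m (A *m C) = C'^T *m G *m C ->
  (A *m C)^T *m G *m (A *m C') = C^T *m G *m C'.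
  by move=> e; rewrite -[LHS]frame_tr e frame_tr.
have PP : (A *m P)^T *m G *m (A *m P) = P^T *m G *m P.
  by rewrite AP' frame_form (frame_PP fr) !(trmx0, mul0mx, mulmx0, addr0).
have BP : (A *m B)^T *m G *m (A *m P) = B^T *m G *m P.
  by rewrite AP' AB' frame_form frame_BP !(trmx0, mul0mx, mulmx0, addr0).
have ZP : (A *m Z)^T *m G *m (A *m P) = Z^T *m G *m P.
  rewrite AP' AZ frame_form (frame_ZP fr).
  by rewrite !(trmx0, mul0mx, mulmx0, addr0, add0r).
have BB : (A *m B)^T *m G *m (A *m B) = B^T *m G *m B.
  by rewrite AB' frame_form !(trmx0, mul0mx, mulmx0, addr0, add0r).
have ZB : (A *m Z)^T *m G *m (A *m B) = Z^T *m G *m B.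
  rewrite AB' AZ frame_form (frame_ZB fr) !(mulmx0, addr0, add0r) -HX.
  by rewrite addrC.
have ZZ : (A *m Z)^T *m G *m (A *m Z) = Z^T *m G *m Z.
  by rewrite AZ frame_form.
apply: frame_ext; apply: frame_ext_tr; rewrite E [RHS]mulmxA //; exact: S.
Qed.

Lemma blocks_of_isometry : A^T *m G *m A = G ->
  [/\ M^T *m D = 1%:M, c^T *m g *m c = g & D^T *m H + X^T *m g *m c = 0].
Proof.
move=> AG.
have E p q (C : 'M[K]_(N, p)) (C' : 'M[K]_(N, q)) :
  (A *m C)^T *m G *m (A *m C') = C^T *m G *m C'.
  by rewrite trmx_mul -[in RHS]AG !mulmxA.
have AP' : A *m P = P *m M + B *m 0 + Z *m 0 by rewrite !mulmx0 !addr0.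
have AB' : A *m B = P *m H + B *m c + Z *m 0 by rewrite !mulmx0 !addr0.
split.
- by rewrite -frame_PZ -E AP' AZ frame_form !(trmx0, mul0mx, addr0).
- by rewrite -[RHS]E AB' frame_form !(trmx0, mul0mx, mulmx0, addr0, add0r).
rewrite -[RHS](frame_ZB fr) -[RHS]E AB' AZ frame_form.
by rewrite !(mulmx0, addr0, add0r) addrC.
Qed.

End Isometry.

(** An isometry preserving U preserves its orthogonal: pairing A B with A P = P M gives zero, and M
    is invertible. *)
Lemma isometry_blocks (A : 'M[K]_N) (M : 'M[K]_2) :
  A^T *m G *m A = G -> A *m P = P *m M -> M \in unitmx ->
  A *m B = P *m (coP *m (A *m B)) + B *m (coB *m (A *m B)).
Proof.
move=> AG AP Mu; rewrite {1}(frame_dec (A *m B)).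
suff -> : coZ *m (A *m B) = 0 by rewrite mulmx0 addr0.
have Mu' : M^T \in unitmx by rewrite unitmx_tr.
rewrite -[LHS](mulKmx Mu') (_ : M^T *m _ = 0) ?mulmx0//.
have -> : M^T *m (coZ *m (A *m B)) = (A *m P)^T *m G *m (A *m B).
  by rewrite AP trmx_mul !mulmxA.
by rewrite trmx_mul -(frame_PB fr) -[in RHS]AG !mulmxA.
Qed.

Lemma gram_isometry (A : 'M[K]_N) (M : 'M[K]_2) :
  A^T *m G *m A = G -> A *m P = P *m M -> M \in unitmx ->
  (coB *m (A *m B))^T *m g *m (coB *m (A *m B)) = g.
Proof.
move=> AG AP Mu; have AB := isometry_blocks AG AP Mu.
by have [] := blocks_of_isometry AP AB (frame_dec (A *m Z)) AG.
Qed.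

End Coordinates.

(** All fields but the last are matrix identities, which [f] preserves. The spanning condition is
    first turned into one: the identity matrix is the sum of the three projectors of the frame. *)
Lemma frame_map (K K' : fieldType) (f : {rmorphism K -> K'}) N m
  (G : 'M[K]_N) (P : 'M[K]_(N, 2)) (B : 'M[K]_(N, m)) (Z : 'M[K]_(N, 2)) :
  frame G P B Z ->
  frame (map_mx f G) (map_mx f P) (map_mx f B) (map_mx f Z).
Proof.
move=> fr; split.
- by rewrite map_trmx (frame_sym fr).
- by rewrite map_trmx -!map_mxM (frame_PP fr) map_mx0.
- by rewrite map_trmx -!map_mxM (frame_PB fr) map_mx0.
- by rewrite map_trmx -!map_mxM (frame_ZP fr) map_mx1.
- by rewrite map_trmx -!map_mxM (frame_ZB fr) map_mx0.
- by rewrite map_trmx -!map_mxM map_unitmx (frame_BB fr).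
move=> v Pv; exists (map_mx f (coP G P Z) *m v), (map_mx f (coB G B) *m v).
have e : 1%:M = map_mx f P *m map_mx f (coP G P Z) +
    map_mx f B *m map_mx f (coB G B) + map_mx f Z *m map_mx f (coZ G P).
  rewrite -!map_mxM -!map_mxD -(map_mx1 f) {1}(frame_dec fr 1%:M).
  by rewrite 3![_ *m 1%:M]mulmx1.
have Zv : map_mx f (coZ G P) *m v = 0 by rewrite map_mxM -map_trmx.
rewrite -[LHS]mul1mx {1}e 2!mulmxDl -[X in _ + X]mulmxA Zv mulmx0 addr0.
by rewrite !mulmxA.
Qed.

Lemma coP_map (K K' : fieldType) (f : {rmorphism K -> K'}) N
  (G : 'M[K]_N) (P Z : 'M[K]_(N, 2)) :
  coP (map_mx f G) (map_mx f P) (map_mx f Z) = map_mx f (coP G P Z).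
Proof. by rewrite /coP !(map_mxB, map_mxM, map_trmx). Qed.

Lemma coB_map (K K' : fieldType) (f : {rmorphism K -> K'}) N m
  (G : 'M[K]_N) (B : 'M[K]_(N, m)) :
  coB (map_mx f G) (map_mx f B) = map_mx f (coB G B).
Proof. by rewrite /coB !(map_invmx, map_mxM, map_trmx). Qed.

Lemma coZ_map (K K' : fieldType) (f : {rmorphism K -> K'}) N
  (G : 'M[K]_N) (P : 'M[K]_(N, 2)) :
  coZ (map_mx f G) (map_mx f P) = map_mx f (coZ G P).
Proof. by rewrite /coZ !(map_mxM, map_trmx). Qed.

Lemma elt_map (K K' : fieldType) (f : {rmorphism K -> K'}) N m
  (G : 'M[K]_N) (P : 'M[K]_(N, 2)) (B : 'M[K]_(N, m)) (Z : 'M[K]_(N, 2))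
  M c D H X J :
  elt (map_mx f G) (map_mx f P) (map_mx f B) (map_mx f Z) (map_mx f M)
    (map_mx f c) (map_mx f D) (map_mx f H) (map_mx f X) (map_mx f J) =
  map_mx f (elt G P B Z M c D H X J).
Proof. by rewrite /elt coP_map coB_map coZ_map !(map_mxD, map_mxM). Qed.

End Frames.

(** * Integral matrices *)

Local Notation mxint A := (A \is a mxOver Num.int).

Lemma trmx_add (K : zmodType) p q (A A' : 'M[K]_(p, q)) :
  (A + A')^T = A^T + A'^T.
Proof. exact: raddfD. Qed.

Lemma trmx_sub (K : zmodType) p q (A A' : 'M[K]_(p, q)) :
  (A - A')^T = A^T - A'^T.
Proof. exact: raddfB. Qed.

Lemma trmx_opp (K : zmodType) p q (A : 'M[K]_(p, q)) : (- A)^T = - A^T.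
Proof. exact: raddfN. Qed.

Section IntegralMatrices.

Lemma ofint_mxint p q (A : 'M[int]_(p, q)) : mxint (ofint rat A).
Proof. by apply/mxOverP => i j; rewrite mxE intr_int. Qed.

Lemma mxintP p q (A : 'M[rat]_(p, q)) :
  mxint A -> exists A' : 'M[int]_(p, q), A = ofint rat A'.
Proof.
move=> /mxOverP iA; exists (map_mx Num.floor A).
by apply/matrixP => i j; rewrite !mxE floorK.
Qed.

Lemma mxintM p q r (A : 'M[rat]_(p, q)) (A' : 'M[rat]_(q, r)) :
  mxint A -> mxint A' -> mxint (A *m A').
Proof. exact: mxOverM. Qed.

Lemma mxintD p q (A A' : 'M[rat]_(p, q)) :
  mxint A -> mxint A' -> mxint (A + A').
Proof.
move=> /mxOverP iA /mxOverP iA'; apply/mxOverP => i j.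
by rewrite mxE rpredD.
Qed.

Lemma mxintN p q (A : 'M[rat]_(p, q)) : mxint A -> mxint (- A).
Proof. by move=> /mxOverP iA; apply/mxOverP => i j; rewrite mxE rpredN. Qed.

Lemma mxintB p q (A A' : 'M[rat]_(p, q)) :
  mxint A -> mxint A' -> mxint (A - A').
Proof. by move=> iA iA'; apply: mxintD => //; exact: mxintN. Qed.

Lemma mxint_tr p q (A : 'M[rat]_(p, q)) : mxint A -> mxint A^T.
Proof. by move=> /mxOverP iA; apply/mxOverP => i j; rewrite mxE. Qed.

Lemma mxint_cols p q (A : 'M[rat]_(p, q)) :
  (forall j, mxint (col j A)) -> mxint A.
Proof.
by move=> H; apply/mxOverP => i j; have /mxOverP/(_ i 0) := H j; rewrite mxE.
Qed.

Lemma mxint11 (a : 'M[rat]_1) : a 0 0 \is a Num.int -> mxint a.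
Proof. by move=> ia; apply/mxOverP => i j; rewrite !ord1. Qed.

Lemma ofintM (K : pzRingType) p q r (A : 'M[int]_(p, q)) (A' : 'M[int]_(q, r)) :
  ofint K (A *m A') = ofint K A *m ofint K A'.
Proof. by rewrite /ofint map_mxM. Qed.

Lemma ofint_tr (K : pzRingType) p q (A : 'M[int]_(p, q)) :
  ofint K A^T = (ofint K A)^T.
Proof. by rewrite /ofint map_trmx. Qed.

Lemma ofint1 (K : pzRingType) p : ofint K (1%:M : 'M[int]_p) = 1%:M.
Proof. by rewrite /ofint map_mx1. Qed.

Lemma ofint_inj (K : numDomainType) p q : injective (@ofint K p q).
Proof.
move=> A A' /matrixP e; apply/matrixP => i j; have := e i j.
by rewrite !mxE => /intr_inj.
Qed.

Lemma ratr_ofint (K : numFieldType) p q (A : 'M[int]_(p, q)) :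
  map_mx ratr (ofint rat A) = ofint K A.
Proof. by apply/matrixP => i j; rewrite !mxE ratr_int. Qed.

Lemma clear_denominators p (v : 'cV[rat]_p) :
  exists (k : int) (x : 'cV[int]_p), k != 0 /\ k%:~R *: v = ofint rat x.
Proof.
pose k := \prod_i denq (v i 0).
have iv : mxint (k%:~R *: v).
  apply/mxOverP => i j; rewrite ord1 mxE /k (bigD1 i)//= rmorphM /= mulrAC.
  by rewrite [_ * v i 0]mulrC -numqE rpredM ?intr_int.
have [x e] := mxintP iv; exists k, x; split=> //.
by apply/prodf_neq0 => i _; exact: denq_neq0.
Qed.

End IntegralMatrices.

Lemma bilformE (K : comPzRingType) N (G : 'M[int]_N) p q
    (X : 'M[K]_(N, p)) (Y : 'M[K]_(N, q)) i j :
  (X^T *m ofint K G *m Y) i j = bilform G (col i X) (col j Y).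
Proof.
rewrite /bilform !colE trmx_mul trmx_delta !mulmxA -colE [RHS]mxE.
by rewrite -!mulmxA -rowE [RHS]mxE.
Qed.

Lemma basU_mul (K : pzRingType) N (z w : 'cV[K]_N) (c : 'cV[K]_2) :
  row_mx z w *m c = z *m (c 0 0)%:M + w *m (c 1 0)%:M.
Proof.
have e : c = @col_mx K 1 1 1 (c 0 0)%:M (c 1 0)%:M.
  apply/matrixP => i j; rewrite ord1 mxE; case: splitP => k /= ik.
    by rewrite ord1 mxE mulr1n; congr (c _ _); apply: val_inj; rewrite /= ik ord1.
  by rewrite ord1 mxE mulr1n; congr (c _ _); apply: val_inj; rewrite /= ik ord1.
by rewrite {1}e [LHS](@mul_row_col _ N 1 1 1).
Qed.

Lemma col0_pair (K : pzRingType) N (z w : 'cV[K]_N) :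
  col 0 (row_mx z w : 'M[K]_(N, 2)) = z.
Proof.
apply/matrixP => i j; rewrite ord1 !mxE; case: splitP => k //=.
by rewrite ord1.
Qed.

Lemma col1_pair (K : pzRingType) N (z w : 'cV[K]_N) :
  col 1 (row_mx z w : 'M[K]_(N, 2)) = w.
Proof.
apply/matrixP => i j; rewrite ord1 !mxE; case: splitP => k //=.
  by rewrite ord1.
by rewrite ord1.
Qed.

Lemma map_pair (K K' : Type) (f : K -> K') N (z w : 'cV[K]_N) :
  map_mx f (row_mx z w : 'M[K]_(N, 2)) = row_mx (map_mx f z) (map_mx f w).
Proof. exact: (@map_row_mx _ _ f N 1 1 z w). Qed.

Lemma row_mx_cols (K : Type) N (X : 'M[K]_(N, 2)) :
  (row_mx (col 0 X) (col 1 X) : 'M[K]_(N, 2)) = X.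
Proof.
apply/matrixP => i j; rewrite mxE; case: splitP => k /= jk; rewrite mxE;
  by congr (X _ _); apply: val_inj; rewrite /= jk ord1.
Qed.

Lemma ord2P (i : 'I_2) : i = 0 \/ i = 1.
Proof.
by case: i => [[|[|//]] ?]; [left|right]; apply: val_inj.
Qed.

Lemma pairmxE (K : pzRingType) N (X Y : 'M[K]_(N, 2)) :
  col 0 X = col 0 Y -> col 1 X = col 1 Y -> X = Y.
Proof.
move=> /matrixP e0 /matrixP e1; apply/matrixP => i j.
by case: (ord2P j) => ->; [have := e0 i 0|have := e1 i 0]; rewrite !mxE.
Qed.

Lemma mx2P (K : Type) (X Y : 'M[K]_2) :
  X 0 0 = Y 0 0 -> X 0 1 = Y 0 1 -> X 1 0 = Y 1 0 -> X 1 1 = Y 1 1 -> X = Y.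
Proof.
move=> e00 e01 e10 e11; apply/matrixP => i j.
by case: (ord2P i) => ->; case: (ord2P j) => ->.
Qed.

(** * The lattice at the cusp *)

Lemma ofint_int p q (A : 'M[int]_(p, q)) : ofint int A = A.
Proof. by apply/matrixP => i j; rewrite mxE intz. Qed.

Lemma lat_mxint N' (v : 'cV[rat]_N') : lat v <-> mxint v.
Proof.
split=> [[x _ <-]|/mxintP[x ->]]; first exact: ofint_mxint.
by exists x.
Qed.

Lemma dual_mxint N' (G' : 'M[int]_N') (v : 'cV[rat]_N') :
  dual_lat G' v <-> mxint (v^T *m ofint rat G').
Proof.
split=> [dv|iv x /lat_mxint ix]; last first.
  by have /mxOverP := mxintM iv ix; apply.
apply/mxOverP => i j; rewrite ord1.
have := dv (delta_mx j 0); rewrite /bilform -colE mxE; apply.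
by apply/lat_mxint/mxOverP => k l; rewrite mxE; case: (_ && _).
Qed.

Lemma dual_cols N' q (G' : 'M[int]_N') (X : 'M[rat]_(N', q)) :
  mxint (X^T *m ofint rat G') <-> forall j, dual_lat G' (col j X).
Proof.
have rowE j : row j (X^T *m ofint rat G') = (col j X)^T *m ofint rat G'.
  by rewrite row_mul tr_col.
split=> [iX j|H].
  by apply/dual_mxint; rewrite -rowE; apply/mxOverP => k l;
    have /mxOverP/(_ j l) := iX; rewrite [in X in _ -> X]mxE.
apply/mxOverP => j l; have /dual_mxint := H j; rewrite -rowE.
by move/mxOverP/(_ 0 l); rewrite mxE.
Qed.

Record cusp_data N m (G : 'M[int]_N) (I : set 'cV[int]_N) (z w : 'cV[int]_N)
  (zeta ups : 'cV[rat]_N) (B : 'M[int]_(N, m)) : Prop := CuspData {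
  cusp_even : even_lattice G ;
  cusp_unit : ofint rat G \in unitmx ;
  cusp_iso : isotropic_sublattice G I ;
  cusp_basis : Zbasis I z w ;
  cusp_zeta : dual_lat G zeta ;
  cusp_ups : dual_lat G ups ;
  cusp_zeta_z : bilform G zeta (ofint rat z) = 1 ;
  cusp_zeta_w : bilform G zeta (ofint rat w) = 0 ;
  cusp_ups_z : bilform G ups (ofint rat z) = 0 ;
  cusp_ups_w : bilform G ups (ofint rat w) = 1 ;
  cusp_Lambda : Lambda_basis G I B }.

Section Cusp.
Context (N m : nat) (G : 'M[int]_N) (I : set 'cV[int]_N) (z w : 'cV[int]_N)
  (zeta ups : 'cV[rat]_N) (B : 'M[int]_(N, m)).
Hypothesis cd : cusp_data G I z w zeta ups B.
Let even_G := cusp_even cd.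
Let nondeg_G := cusp_unit cd.
Let isoI := cusp_iso cd.
Let basI := cusp_basis cd.
Let dual_zeta := cusp_zeta cd.
Let dual_ups := cusp_ups cd.
Let zeta_z := cusp_zeta_z cd.
Let zeta_w := cusp_zeta_w cd.
Let ups_z := cusp_ups_z cd.
Let ups_w := cusp_ups_w cd.
Let basB := cusp_Lambda cd.

Local Notation Gq := (ofint rat G).
Local Notation P := (ofint rat (basU z w)).
Local Notation g := (ofint rat (gramLambda G B)).

Definition cuspZ : 'M[rat]_(N, 2) := row_mx zeta ups.
Local Notation Z := cuspZ.
(** The columns of [B] need not be orthogonal to zeta and ups. Subtracting a combination of [P]
    moves them into the complement tilde W without changing their classes modulo U, so this is a
    basis of tilde Lambda. *)
Definition cuspB : 'M[rat]_(N, m) :=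
  ofint rat B - P *m (Z^T *m Gq *m ofint rat B).
Local Notation Bt := cuspB.

Lemma bilformC (K : comPzRingType) (x y : 'cV[K]_N) :
  bilform G x y = bilform G y x.
Proof.
by rewrite -[LHS]trace_mx11 -mxtrace_tr trace_mx11 !trmx_mul trmxK -ofint_tr
  even_G.1 mulmxA.
Qed.

Lemma cusp_sym : Gq^T = Gq.
Proof. by rewrite -ofint_tr even_G.1. Qed.

Lemma cusp_form_tr p q (A : 'M[rat]_(N, p)) (C : 'M[rat]_(N, q)) :
  (A^T *m Gq *m C)^T = C^T *m Gq *m A.
Proof. by rewrite !trmx_mul trmxK cusp_sym mulmxA. Qed.

Lemma intI (y : 'cV[int]_N) : I y <-> exists c, y = basU z w *m c.
Proof.
rewrite basI.1; split=> [[a _ [b _ <-]]|[c ->]].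
  exists (\col_i if i == 0 then a else b).
  by rewrite basU_mul !mxE /= !mul_mx_scalar.
by exists (c 0 0) => //; exists (c 1 0) => //; rewrite basU_mul !mul_mx_scalar.
Qed.

Lemma bilform11 (v x : 'cV[rat]_N) :
  v^T *m Gq *m x = (bilform G v x)%:M.
Proof. exact: mx11_scalar. Qed.

Lemma cuspZ_dual : mxint (Z^T *m Gq).
Proof.
apply/dual_cols => j; case: (ord2P j) => ->.
  by rewrite col0_pair.
by rewrite col1_pair.
Qed.

Lemma cuspZP : Z^T *m Gq *m P = 1%:M.
Proof.
apply: mx2P; rewrite bilformE /basU /ofint map_pair ?col0_pair ?col1_pair
  ?zeta_z ?zeta_w ?ups_z ?ups_w mxE //.
Qed.

Lemma basUI (c : 'cV[int]_2) : I (basU z w *m c).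
Proof. by apply/intI; exists c. Qed.

Lemma cuspPP : P^T *m Gq *m P = 0.
Proof.
rewrite -ofint_tr -!ofintM (_ : _ *m _ = 0) ?/ofint ?map_mx0//.
apply/matrixP => i j; rewrite -[G]ofint_int bilformE mxE !colE.
by apply: isoI; exact: basUI.
Qed.

Lemma cuspPB : P^T *m Gq *m ofint rat B = 0.
Proof.
rewrite -ofint_tr -!ofintM (_ : _ *m _ = 0) ?/ofint ?map_mx0//.
apply/matrixP => i j; rewrite -[G]ofint_int bilformE mxE !colE.
by rewrite bilformC; apply: basB.1; exact: basUI.
Qed.

Lemma Lambda_coef (x : 'cV[int]_N) : (basU z w)^T *m G *m x = 0 ->
  exists c c', x = B *m c + basU z w *m c'.
Proof.
move=> Px; have [] := basB.2 x.
  move=> y /intI[c ->]; rewrite bilformC /bilform ofint_int trmx_mul.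
  by rewrite -!mulmxA (mulmxA (basU z w)^T) Px mulmx0 mxE.
move=> c [/intI[c' e] _]; exists c, c'.
by rewrite -e addrC subrK.
Qed.

Lemma cusp_PBt : P^T *m Gq *m Bt = 0.
Proof. by rewrite mulmxBr mulmxA cuspPP mul0mx subr0 cuspPB. Qed.

Lemma cusp_ZBt : Z^T *m Gq *m Bt = 0.
Proof. by rewrite mulmxBr mulmxA cuspZP mul1mx subrr. Qed.

(** Replacing [B] by [Bt] changes a vector by a combination of [P] that is integral because zeta and
    ups lie in L^*. *)
Lemma cusp_int_span (v : 'cV[rat]_N) : mxint v -> P^T *m Gq *m v = 0 ->
  exists2 c : 'cV[rat]_m, mxint c & exists2 a, mxint a & v = P *m a + Bt *m c.
Proof.
move=> /mxintP[x ->] Px.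
have [|c [c' ->]] := @Lambda_coef x.
  by apply: (@ofint_inj rat); rewrite !ofintM ofint_tr Px /ofint map_mx0.
exists (ofint rat c); first exact: ofint_mxint.
exists (ofint rat c' + Z^T *m Gq *m ofint rat B *m ofint rat c).
  apply: mxintD; first exact: ofint_mxint.
  exact: mxintM (mxintM cuspZ_dual (ofint_mxint _)) (ofint_mxint _).
rewrite /ofint map_mxD !map_mxM -/(ofint _ _) mulmxBl mulmxDr !mulmxA.
by mxabel.
Qed.

Lemma cusp_span (v : 'cV[rat]_N) : P^T *m Gq *m v = 0 ->
  exists a b, v = P *m a + Bt *m b.
Proof.
move=> Pv; have [k [x [k0 e]]] := clear_denominators v.
have k0' : k%:~R != 0 :> rat by rewrite intr_eq0.
have [|c _ [a _ xE]] := cusp_int_span (ofint_mxint x).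
  by rewrite -e -scalemxAr Pv scaler0.
exists (k%:~R^-1 *: a), (k%:~R^-1 *: c).
rewrite -!scalemxAr -scalerDr -xE -e scalerA mulVf// scale1r.
by [].
Qed.

Lemma cusp_gram : Bt^T *m Gq *m Bt = g.
Proof.
have PBt : P^T *m Gq *m Bt = 0 := cusp_PBt.
have BP : (ofint rat B)^T *m Gq *m P = 0.
  by rewrite -cusp_form_tr cuspPB trmx0.
have BtP : Bt^T *m Gq *m P = 0 by rewrite -cusp_form_tr PBt trmx0.
rewrite {2}/cuspB mulmxBr (mulmxA _ P) BtP mul0mx subr0.
rewrite -cusp_form_tr /cuspB mulmxBr (mulmxA _ P) BP mul0mx subr0 cusp_form_tr.
by rewrite /gramLambda !ofintM ofint_tr.
Qed.

(** A vector in the radical of W lifts to [Bt *m x], which is orthogonal to all three parts of V and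
    hence zero by nondegeneracy of V. Then x vanishes because the columns of [B] are independent
    modulo I. *)
Lemma cusp_nondeg : g \in unitmx.
Proof.
rewrite unitmxE unitfE; apply/negP => /eqP/eqP/det0P[v v0 vg].
case/eqP: v0; pose x := v^T.
have gx : Bt^T *m Gq *m (Bt *m x) = 0.
  by rewrite mulmxA -cusp_form_tr cusp_gram -trmx_mul vg trmx0.
have Gx : Gq *m (Bt *m x) = 0.
  have H (y : 'cV[rat]_N) : y^T *m (Gq *m (Bt *m x)) = 0.
    have [|a [b]] := @cusp_span (y - Z *m (P^T *m Gq *m y)).
      have PZ : P^T *m Gq *m Z = 1%:M.
        by rewrite -cusp_form_tr cuspZP trmx1.
      by rewrite mulmxBr (mulmxA _ Z) PZ mul1mx subrr.
    move/(canRL (subrK _)) ->; rewrite 2!linearD /= 2!(mulmxDl _ _ (Gq *m _)).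
    have K0 q (C : 'M[rat]_(N, q)) c : C^T *m Gq *m Bt = 0 ->
        (C *m c)^T *m (Gq *m (Bt *m x)) = 0.
      by move=> e; rewrite trmx_mul -mulmxA (mulmxA C^T) (mulmxA _ Bt) e !mul0mx
        mulmx0.
    rewrite (K0 _ _ _ _ cusp_PBt) (K0 _ _ _ _ cusp_ZBt) trmx_mul -mulmxA.
    by rewrite (mulmxA Bt^T) gx mulmx0 !addr0.
  apply/matrixP => i j; rewrite ord1.
  by have /matrixP/(_ 0 0) := H (delta_mx i 0); rewrite trmx_delta -rowE !mxE.
have Bx : Bt *m x = 0 by rewrite -[LHS](mulKmx nondeg_G) Gx mulmx0.
(* Independence modulo I is available for integral coefficients only: 0 and a multiple [c] of [x]
   are both coefficient vectors of the zero class, hence equal. *)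
have [k [c [k0 e]]] := clear_denominators x.
have [] := basB.2 0; first by move=> y _; rewrite /bilform trmx0 !mul0mx mxE.
move=> c0 [_ uniq]; have u0 : c0 = 0.
  by apply: uniq; rewrite mulmx0 subr0; apply/intI; exists 0; rewrite mulmx0.
have uc : c0 = c.
  apply: uniq; rewrite sub0r; apply/intI.
  have /mxintP[d de] : mxint (- (Z^T *m Gq *m ofint rat B *m ofint rat c)).
    apply: mxintN; exact: mxintM (mxintM cuspZ_dual (ofint_mxint _)) (ofint_mxint _).
  exists d; apply: (@ofint_inj rat); rewrite [in RHS]ofintM -de mulmxN.
  rewrite (_ : ofint rat (- _) = - (ofint rat B *m ofint rat c)); last first.
    by rewrite -ofintM /ofint map_mxN.
  have : Bt *m ofint rat c = 0 by rewrite -e -scalemxAr Bx scaler0.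
  by rewrite mulmxBl => /eqP; rewrite subr_eq0 => /eqP ->; rewrite !mulmxA.
have : x = 0.
  apply: (scalerI (a := k%:~R)); first by rewrite intr_eq0.
  by rewrite e -uc u0 scaler0 /ofint map_mx0.
by move=> x0; rewrite -[v]trmxK -/x x0 trmx0.
Qed.

Lemma cusp_frame : frame Gq P Bt Z.
Proof.
split; [exact: cusp_sym|exact: cuspPP|exact: cusp_PBt|exact: cuspZP|
  exact: cusp_ZBt| |exact: cusp_span].
by rewrite cusp_gram cusp_nondeg.
Qed.

End Cusp.

(** * Vectors of L^* orthogonal to U, and iota^* and b_M in coordinates *)

Section DualLattice.
Context (N m : nat) (G : 'M[int]_N) (I : set 'cV[int]_N) (z w : 'cV[int]_N)
  (zeta ups : 'cV[rat]_N) (B : 'M[int]_(N, m)).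
Hypothesis cd : cusp_data G I z w zeta ups B.

Local Notation Gq := (ofint rat G).
Local Notation P := (ofint rat (basU z w)).
Local Notation g := (ofint rat (gramLambda G B)).
Local Notation Z := (cuspZ zeta ups).
Local Notation Bt := (cuspB G z w zeta ups B).
Let fr : frame Gq P Bt Z := cusp_frame cd.

Lemma cuspB_int : mxint Bt.
Proof.
apply: mxintB; first exact: ofint_mxint.
apply: mxintM (ofint_mxint _) _.
exact: mxintM (cuspZ_dual cd) (ofint_mxint _).
Qed.

Lemma bilform_int (v x : 'cV[rat]_N) :
  bilform G v x \is a Num.int <-> mxint (v^T *m Gq *m x).
Proof.
split=> [iv|/mxOverP]; last exact.
by apply: mxint11.
Qed.

(** The double dual of L is L: the vector [invmx Gq *m delta_mx i 0] lies in L^* and pairs with a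
    vector to give its coordinate i. *)
Lemma mxint_double_dual q (X : 'M[rat]_(N, q)) :
  (forall d, dual_lat G d -> mxint (d^T *m Gq *m X)) -> mxint X.
Proof.
move=> H; apply/mxOverP => i j.
have e : (invmx Gq *m delta_mx i 0)^T *m Gq = delta_mx (0 : 'I_1) i.
  apply: trmx_inj; rewrite trmx_mul trmxK (cusp_sym cd).
  by rewrite mulKVmx ?(cusp_unit cd)// trmx_delta.
have := H (invmx Gq *m delta_mx i (0 : 'I_1)); rewrite e -rowE => iX.
have /iX/mxOverP/(_ 0 j) : dual_lat G (invmx Gq *m delta_mx i (0 : 'I_1)).
  apply/dual_mxint; rewrite e; apply/mxOverP => k l.
  by rewrite mxE; case: (_ && _).
by rewrite mxE.
Qed.

Lemma coB_int q (X : 'M[rat]_(N, q)) :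
  mxint X -> P^T *m Gq *m X = 0 -> mxint (coB Gq Bt *m X).
Proof.
move=> /mxOverP iX PX; apply: mxint_cols => j; rewrite colE -mulmxA -colE.
have [||c ic [a _ ->]] := cusp_int_span cd (v := col j X).
- by apply/mxOverP => k l; rewrite mxE.
- by rewrite colE mulmxA PX mul0mx.
by rewrite mulmxDr !(mulmxA (coB _ _)) (coBP fr) (coBB fr) mul0mx mul1mx add0r.
Qed.

Lemma coP_int q (X : 'M[rat]_(N, q)) :
  mxint X -> P^T *m Gq *m X = 0 -> mxint (coP Gq P Z *m X).
Proof.
move=> iX PX; rewrite mulmxBl -[X in _ - X]mulmxA PX mulmx0 subr0.
exact: mxintM (cuspZ_dual cd) iX.
Qed.

Lemma coZ_int q (X : 'M[rat]_(N, q)) : mxint X -> mxint (coZ Gq P *m X).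
Proof.
move=> iX; apply: mxintM iX; apply: mxintM (ofint_mxint _).
by apply: mxint_tr; exact: ofint_mxint.
Qed.

(** The vectors of L orthogonal to U are the kernel of an integral matrix, hence a direct summand of
    L. The Smith normal form exhibits the projector. *)
Lemma kernel_projector : exists E : 'M[rat]_N,
  [/\ mxint E, P^T *m Gq *m E = 0 &
   forall q (X : 'M[rat]_(N, q)), P^T *m Gq *m X = 0 -> E *m X = X].
Proof.
have [L uL [V uV [d _ e]]] := int_Smith_normal_form ((basU z w)^T *m G).
set D := \matrix_(i, j) _ in e.
(* [F] keeps exactly the coordinates whose column in the Smith form is zero. *)
pose F := diag_mx (\row_j ([forall i, D i j == 0]%:R : int)).
exists (ofint rat (invmx V *m F *m V)); split; first exact: ofint_mxint.
  rewrite -ofint_tr -!ofintM e -!mulmxA (mulmxA V) mulmxV// mul1mx.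
  rewrite (mulmxA D) (_ : D *m F = 0) ?mul0mx ?mulmx0 /ofint ?map_mx0//.
  apply/matrixP => i j; rewrite mul_mx_diag mxE [in RHS]mxE [X in _ * X]mxE.
  case: forallP => [/(_ i)/eqP ->|_]; first by rewrite mul0r.
  by rewrite mulr0.
move=> q X PX.
have ofintVK p (U : 'M[int]_p) r (Y : 'M[rat]_(p, r)) : U \in unitmx ->
    ofint rat (invmx U) *m (ofint rat U *m Y) = Y.
  by move=> uU; rewrite mulmxA -ofintM mulVmx// ofint1 mul1mx.
have DX : ofint rat D *m (ofint rat V *m X) = 0.
  rewrite -[LHS](ofintVK _ L)// [X in _ *m X](_ : _ = 0) ?mulmx0// -[RHS]PX.
  by rewrite -ofint_tr -ofintM e 2!ofintM !mulmxA.
suff FX : ofint rat F *m (ofint rat V *m X) = ofint rat V *m X.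
  by rewrite 2!ofintM -!mulmxA FX ofintVK.
move: (ofint rat V *m X) DX => Y DY; apply/matrixP => j k.
rewrite /ofint map_diag_mx mul_diag_mx mxE [X in X * _](_ : _ =
  [forall i, D i j == 0]%:R); last by rewrite !mxE; case: [forall _, _].
case: (boolP [forall i, D i j == 0]) => [_|/forallPn[i Dij]].
  by rewrite mul1r.
have ij : i = j :> nat.
  by apply/eqP; apply: contraNT Dij => /negbTE ne; rewrite mxE ne mulr0n.
rewrite mul0r; have /matrixP/(_ i k) := DY; rewrite mxE (bigD1 j)//= big1 => [|l lj].
  rewrite [in RHS]mxE addr0 mxE => /eqP; rewrite mulf_eq0 intr_eq0 (negbTE Dij) /=.
  by move=> /eqP ->.
rewrite !mxE ij; case: eqP => [/val_inj jl|_]; last by rewrite mul0r.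
by rewrite jl eqxx in lj.
Qed.

Lemma form_BP_coord (d : 'cV[rat]_m) (c : 'cV[rat]_2) a b (t : 'cV[rat]_2) :
  (Bt *m d - P *m c)^T *m Gq *m (P *m a + Bt *m b + Z *m t) =
  d^T *m g *m b - c^T *m t.
Proof.
rewrite (_ : Bt *m d - P *m c = P *m (- c) + Bt *m d + Z *m 0); last first.
  by rewrite mulmx0 addr0 mulmxN addrC.
rewrite (frame_form fr) (cusp_gram cd) trmx0 !mul0mx !addr0 linearN /= mulNmx.
by rewrite addrC.
Qed.

(* The functional (d, .) on the vectors of L orthogonal to U extends to L along
   the integral projector. *)
Lemma dual_lift (d : 'cV[rat]_m) : mxint (d^T *m g) ->
  exists c, dual_lat G (Bt *m d - P *m c).
Proof.
move=> id; have [E [iE PE EE]] := kernel_projector.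
have [bE ibE bEX] : exists2 bE : 'M[rat]_(m, N), mxint bE &
    forall q (X : 'M[rat]_(N, q)), P^T *m Gq *m X = 0 -> bE *m X = coB Gq Bt *m X.
  exists (coB Gq Bt *m E); first exact: coB_int.
  by move=> q X PX; rewrite -mulmxA EE.
pose v := invmx Gq *m (bE^T *m g^T *m d).
have vG : v^T *m Gq = d^T *m g *m bE.
  apply: trmx_inj; rewrite trmx_mul trmxK (cusp_sym cd) mulKVmx ?(cusp_unit cd)//.
  by rewrite !trmx_mul trmxK mulmxA.
have vP : P^T *m Gq *m v = 0.
  rewrite -(cusp_form_tr cd) vG -mulmxA bEX ?(frame_PP fr)//.
  by rewrite (coBP fr) !mulmx0 trmx0.
have vB : Bt^T *m Gq *m v = g *m d.
  rewrite -(cusp_form_tr cd) vG -mulmxA bEX ?(frame_PB fr)//.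
  by rewrite (coBB fr) mulmx1 trmx_mul trmxK -(cusp_gram cd) (cusp_form_tr cd).
exists (- (coP Gq P Z *m v)); rewrite mulmxN opprK addrC.
have -> : P *m (coP Gq P Z *m v) + Bt *m d = v.
  rewrite [RHS](frame_dec fr) -[coZ Gq P *m v]/(P^T *m Gq *m v) vP mulmx0 addr0.
  congr (_ + _ *m _); rewrite -[coB _ _ *m v]mulmxA vB (cusp_gram cd).
  by rewrite mulKmx ?(cusp_nondeg cd).
by apply/dual_mxint; rewrite vG; apply: mxintM ibE.
Qed.

Lemma latI_mxint (a : 'cV[rat]_2) : latI z w (P *m a) <-> mxint a.
Proof.
split=> [[c _]|/mxintP[c ->]]; last by exists c; rewrite // ofintM.
rewrite ofintM => /(congr1 (mulmx (coP Gq P Z))).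
by rewrite !mulmxA (coPP fr) !mul1mx => <-; exact: ofint_mxint.
Qed.

Lemma SLIP (M : 'M[int]_2) : SLI G z w M <->
  \det M = 1 /\
  forall c : 'cV_2, dual_lat G (P *m c) -> mxint (c - ofint rat M *m c).
Proof.
by split=> -[dM H]; split=> // c /H; rewrite latI_mxint.
Qed.

Lemma cuspZ_mul (t : 'cV[rat]_2) : Z *m t = t 0 0 *: zeta + t 1 0 *: ups.
Proof. by rewrite basU_mul !mul_mx_scalar. Qed.

Lemma tilIP (u : 'cV[rat]_N) :
  tilI zeta ups u <-> exists2 t : 'cV_2, mxint t & u = Z *m t.
Proof.
split=> [[a _ [b _ <-]]|[t /mxOverP it ->]].
  exists (\col_i if i == 0 then a%:~R else b%:~R).
    by apply/mxOverP => i j; rewrite mxE; case: ifP.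
  by rewrite cuspZ_mul !mxE.
exists (Num.floor (t 0 0)) => //; exists (Num.floor (t 1 0)) => //.
by rewrite cuspZ_mul !floorK.
Qed.

Lemma tilW_orth (x : 'cV[rat]_N) : tilW G z w zeta ups x -> Z^T *m Gq *m x = 0.
Proof.
move=> [_ _ xz xu]; apply/matrixP => i j; rewrite bilformE [RHS]mxE (bilformC cd).
case: (ord2P i) => ->; rewrite ?col0_pair ?col1_pair ord1 (_ : col _ x = x) //;
  by apply/matrixP => k l; rewrite ord1 mxE.
Qed.

Lemma tilW_B (b : 'cV[rat]_m) : tilW G z w zeta ups (Bt *m b).
Proof.
have PB (c : 'cV[rat]_2) : bilform G (Bt *m b) (P *m c) = 0.
  rewrite (bilformC cd) /bilform (form_coord Gq) (frame_PB fr).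
  by rewrite mulmx0 mul0mx mxE.
have ZB (c : 'cV[rat]_2) : bilform G (Bt *m b) (Z *m c) = 0.
  rewrite (bilformC cd) /bilform (form_coord Gq) (frame_ZB fr).
  by rewrite mulmx0 mul0mx mxE.
have := (PB (delta_mx 0 0), PB (delta_mx 1 0), ZB (delta_mx 0 0), ZB (delta_mx 1 0)).
rewrite -!colE /ofint map_pair !(col0_pair, col1_pair).
by move=> [[[]]].
Qed.

(** A vector of L has the form u + x + ut with x representing iota ut, and its pairing with
    [Bt *m d - P *m c] is (d, iota ut) - (c, ut). So the congruence defining iota^* says that this
    vector pairs integrally with L, and iota never has to be constructed as a map. *)
Lemma iota_starP (d : 'cV[rat]_m) (c : 'cV[rat]_2) :
  iota_star G z w zeta ups B d c <-> dual_lat G (Bt *m d - P *m c).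
Proof.
have e (t : 'cV[rat]_2) b : (bilform G (P *m c) (Z *m t) -
    bilform (gramLambda G B) d b)%:M = c^T *m t - d^T *m g *m b.
  rewrite rmorphB /= -!bilform11 (form_coord Gq).
  by rewrite (frame_PZ fr) mulmx1.
split=> [H|/dual_mxint dd ut b].
  move=> x /lat_mxint ix; rewrite bilform_int {1}(frame_dec fr x) form_BP_coord.
  rewrite -opprB -e; apply/mxintN/mxint11; rewrite mxE eqxx mulr1n.
  (* The component of [x] along zeta and ups is in tilde I_L, with [x] itself as the vector of L
     inducing the same functional on I. *)
  have it := coZ_int ix; set t := coZ _ _ *m x in it *.
  set b := coB _ _ *m x; apply: H; split.
    split; first by apply/tilIP; exists t.
    exists x; first exact/lat_mxint.
    move=> _ [k _ <-]; rewrite ofintM (bilformC cd) [RHS](bilformC cd).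
    rewrite /bilform (form_coord Gq) (frame_PZ fr) mulmx1 (trmx_mul P).
    by rewrite /t /coZ -!mulmxA.
  exists (P *m (coP Gq P Z *m x)), (Bt *m b); split.
  - by exists (coP Gq P Z *m x).
  - exact: tilW_B.
  - rewrite -mulmxBl; exists (- (Z^T *m Gq *m ofint rat B *m b)) => //.
    by rewrite mulmxN /cuspB addrAC subrr sub0r mulNmx !mulmxA.
  - by apply/lat_mxint; rewrite -(frame_dec fr).
move=> [[/tilIP[t it ->] _] [u [x [[a _ <-] xW [k _ xk] /lat_mxint iv]]]].
(* The class of [b] modulo U has a unique lift orthogonal to zeta and ups. *)
have xE : x = Bt *m b.
  have {}xk : x = Bt *m b + P *m (k + Z^T *m Gq *m ofint rat B *m b).
    rewrite -[LHS](subrK (ofint rat B *m b)) -xk /cuspB mulmxBl mulmxDr !mulmxA.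
    by mxabel.
  have /eqP := tilW_orth xW; rewrite xk mulmxDr !(mulmxA _ P) !(mulmxA _ Bt).
  rewrite (frame_ZB fr) (frame_ZP fr) mul0mx mul1mx add0r => /eqP ->.
  by rewrite mulmx0 addr0.
have := mxintM dd iv; rewrite xE form_BP_coord -opprB -e => /mxintN/mxOverP.
by move=> /(_ 0 0); rewrite opprK mxE eqxx mulr1n.
Qed.

Lemma bM_pairP (M : 'M[int]_2) (lam mu : 'cV[rat]_m) :
  let X := row_mx lam mu : 'M[rat]_(m, 2) in
  bM_pair G z w zeta ups B M lam mu <->
  mxint (X^T *m g) /\ forall d : 'cV_m, mxint (d^T *m g) ->
    exists2 c, dual_lat G (Bt *m d - P *m c) &
      mxint (X^T *m g *m d - (c - ofint rat M *m c)).
Proof.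
move=> X.
have iX : mxint (X^T *m g) <->
    dual_lat (gramLambda G B) lam /\ dual_lat (gramLambda G B) mu.
  rewrite dual_cols; split=> [H|[dl dm] j].
    by have := (H 0, H 1); rewrite col0_pair col1_pair => -[].
  by case: (ord2P j) => ->; rewrite ?col0_pair ?col1_pair.
have e d : bilform (gramLambda G B) lam d *: ofint rat z +
    bilform (gramLambda G B) mu d *: ofint rat w = P *m (X^T *m g *m d).
  rewrite {3}/ofint map_pair basU_mul !mul_mx_scalar !bilformE.
  by rewrite col0_pair col1_pair (_ : col 0 d = d)//; apply/matrixP => k l;
    rewrite ord1 mxE.
split=> [[dl dm H]|[/iX[dl dm] H]].
  split; first exact/iX.
  move=> d /dual_mxint /H[c /iota_starP dc].
  by rewrite e -mulmxBr latI_mxint; exists c.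
split=> // d /dual_mxint/H[c dc ic]; exists c; first exact/iota_starP.
by rewrite e -mulmxBr latI_mxint.
Qed.

End DualLattice.

(** * Elements of the parabolic group *)

(** Halve the diagonal and keep the off-diagonal entry above it only. The even diagonal will come
    from the evenness of L. *)
Lemma symmetric_part_of_even (s : 'M[int]_2) : s^T = s ->
  (forall i, (2 %| s i i)%Z) -> exists r, r + r^T = s.
Proof.
move=> ss s2; exists (\matrix_(i, j)
  if i == j then (s i i %/ 2)%Z else if i == 0 then s i j else 0).
have e i : (s i i %/ 2)%Z + (s i i %/ 2)%Z = s i i.
  by have /dvdzP[q ->] := s2 i; rewrite mulzK//; ring.
have e10 : s 1 0 = s 0 1 by rewrite -{1}ss mxE.
by apply: mx2P; rewrite !mxE //= ?e ?addr0 ?add0r.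
Qed.

Lemma isometry_unitmx p (g A : 'M[rat]_p) (A' : 'M[int]_p) : g \in unitmx ->
  A^T *m g *m A = g -> A = ofint rat A' -> A' \in unitmx.
Proof.
rewrite !unitmxE !unitfE => ug /(congr1 determinant).
rewrite !det_mulmx det_tr mulrC mulrA => e AE.
have {}e : \det A * \det A = 1 by apply: (mulIf ug); rewrite mul1r.
apply/unitrP; exists (\det A').
have : \det A' * \det A' = 1; last by [].
apply: (@intr_inj rat); rewrite rmorphM /= -[in RHS](rmorph1 intr).
by move: e; rewrite AE /ofint det_map_mx.
Qed.

Lemma block_action_sub p m (A : 'M[rat]_p) (P : 'M[rat]_(p, 2))
    (B : 'M[rat]_(p, m)) (M : 'M[rat]_2) (H : 'M[rat]_(2, m)) (c : 'M[rat]_m)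
    (d : 'cV[rat]_m) (a : 'cV[rat]_2) :
  A *m P = P *m M -> A *m B = P *m H + B *m c ->
  A *m (B *m d - P *m a) - (B *m d - P *m a) =
  P *m (H *m d + (a - M *m a)) + B *m (c *m d - d).
Proof.
move=> AP AB; rewrite !mulmxBr !(mulmxA A) AP AB mulmxDl.
by rewrite !mulmxDr !mulmxN !mulmxA; mxabel.
Qed.

(** With X = K M^T the orthogonality of A Z and A B reads H = - X^T g c. Thus the block of A from W
    to U is determined by X. *)
Lemma block_dual m (M D : 'M[rat]_2) (H : 'M[rat]_(2, m)) (K : 'M[rat]_(m, 2))
    (g c : 'M[rat]_m) :
  M^T *m D = 1%:M -> D^T *m H + K^T *m g *m c = 0 ->
  (K *m M^T)^T *m g *m c = - H.
Proof.
move=> MD HX; have DM : M *m D^T = 1%:M.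
  by apply: mulmx1C; rewrite -[LHS]trmxK trmx_mul trmxK MD trmx1.
rewrite trmx_mul trmxK -!mulmxA -[X in _ *m X](addKr (D^T *m H)).
by rewrite (mulmxA K^T) HX addr0 mulmxN (mulmxA M) DM mul1mx.
Qed.

(** Write A Z = Z + Lm + P M r with Lm = P Y + B K + Z E. The choice of Y makes Lm orthogonal to Z,
    and the term P M r contributes r + r^T since M^T D = 1. So A Z has Gram matrix T exactly when r
    + r^T is minus the Gram matrix of Lm. *)
Lemma synth_gram (T M D r k : 'M[rat]_2) : T^T = T -> M^T *m D = 1%:M ->
  let E := D - 1%:M in let Y := - (T *m E) in
  r + r^T = - (Y^T *m E + k + E^T *m Y + E^T *m T *m E) ->
  (Y + M *m r)^T *m D + k + D^T *m (Y + M *m r) + D^T *m T *m D = T.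
Proof.
move=> Ts MD E Y rE; have DM : D^T *m M = 1%:M.
  by rewrite -[LHS]trmxK trmx_mul trmxK MD trmx1.
rewrite trmx_add mulmxDl (trmx_mul M) -(mulmxA r^T) MD mulmx1 mulmxDr (mulmxA D^T M) DM mul1mx.
have -> : Y^T *m D + r^T + k + (D^T *m Y + r) + D^T *m T *m D =
  (r + r^T) + (Y^T *m D + k + D^T *m Y + D^T *m T *m D) by mxabel.
rewrite rE /Y /E !trmx_opp !trmx_mul !trmx_sub Ts trmx1.
rewrite !(mulmxBl, mulmxBr, mulNmx, mulmxN, mul1mx, mulmx1) !mulmxA.
by mxabel.
Qed.

Lemma synth_action p m (A : 'M[rat]_p) (P Z : 'M[rat]_(p, 2))
    (B : 'M[rat]_(p, m)) (M D J Y r : 'M[rat]_2) (H : 'M[rat]_(2, m))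
    (K : 'M[rat]_(m, 2)) (a t : 'cV[rat]_2) (b : 'cV[rat]_m) :
  A *m P = P *m M -> A *m B = P *m H + B *m 1%:M ->
  A *m Z = P *m J + B *m K + Z *m D -> J = Y + M *m r ->
  A *m (P *m a + B *m b + Z *m t) - (P *m a + B *m b + Z *m t) =
  (P *m Y + B *m K + Z *m (D - 1%:M)) *m t + P *m (M *m r *m t) +
  P *m (M *m a - a + H *m b).
Proof.
move=> AP AB AZ JE.
rewrite !(mulmxDr A) !(mulmxA A) AP AB AZ JE.
by rewrite !(mulmxDl, mulmxDr, mulmxBl, mulmxN, mulNmx, mulmx1) !mulmxA; mxabel.
Qed.

Section Elements.
Context (N m : nat) (G : 'M[int]_N) (I : set 'cV[int]_N) (z w : 'cV[int]_N)
  (zeta ups : 'cV[rat]_N) (B : 'M[int]_(N, m)).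
Hypothesis cd : cusp_data G I z w zeta ups B.

Local Notation Gq := (ofint rat G).
Local Notation P := (ofint rat (basU z w)).
Local Notation g := (ofint rat (gramLambda G B)).
Local Notation Z := (cuspZ zeta ups).
Local Notation Bt := (cuspB G z w zeta ups B).
Local Notation T := (Z^T *m Gq *m Z).
Let fr : frame Gq P Bt Z := cusp_frame cd.

Lemma gram_sym : g^T = g.
Proof. by rewrite -(cusp_gram cd) (cusp_form_tr cd). Qed.

Lemma mxint_P (a : 'cV[rat]_2) : mxint (P *m a) <-> mxint a.
Proof.
split=> ia; last exact: mxintM (ofint_mxint _) ia.
have := coP_int cd ia; rewrite !mulmxA (coPP fr) mul1mx; apply.
by rewrite (frame_PP fr) mul0mx.
Qed.

(** * From an element of Gamma_{L,I} to M, its action on Lambda, and b_M *)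

Section Analysis.
Context (A : 'M[int]_N) (M : 'M[int]_2).
Local Notation Aq := (ofint rat A).
Local Notation Mq := (ofint rat M).
Hypotheses (isoA : Aq^T *m Gq *m Aq = Gq) (AP : A *m basU z w = basU z w *m M)
  (detM : \det M = 1)
  (trivA : forall v, dual_lat G v -> lat (Aq *m v - v)).

Let AqP : Aq *m P = P *m Mq. Proof. by rewrite -!ofintM AP. Qed.
Let Mu : Mq \in unitmx.
Proof. by rewrite unitmxE /ofint det_map_mx detM rmorph1 unitr1. Qed.

Local Notation c := (coB Gq Bt *m (Aq *m Bt)).
Local Notation H := (coP Gq P Z *m (Aq *m Bt)).
Local Notation K := (coB Gq Bt *m (Aq *m Z)).
Local Notation D := (coZ Gq P *m (Aq *m Z)).

Let AB : Aq *m Bt = P *m H + Bt *m c := isometry_blocks fr isoA AqP Mu.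

Let blocks : [/\ Mq^T *m D = 1%:M, c^T *m g *m c = g & D^T *m H + K^T *m g *m c = 0].
Proof.
by have := blocks_of_isometry fr AqP AB (frame_dec fr (Aq *m Z)) isoA;
  rewrite (cusp_gram cd).
Qed.

Let orthAB : P^T *m Gq *m (Aq *m Bt) = 0.
Proof.
rewrite AB mulmxDr !mulmxA (frame_PP fr) (frame_PB fr).
by rewrite !mul0mx addr0.
Qed.

Lemma analysis_SLI : SLI G z w M.
Proof.
apply/(SLIP cd); split=> // a /trivA/lat_mxint.
rewrite mulmxA AqP -mulmxA -mulmxBr mxint_P => /mxintN.
by rewrite opprB.
Qed.

Lemma analysis_gram_int : mxint c.
Proof.
apply: (coB_int cd) => //.
exact: mxintM (ofint_mxint _) (cuspB_int cd).
Qed.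

Let intH : mxint H.
Proof.
apply: (coP_int cd) => //.
exact: mxintM (ofint_mxint _) (cuspB_int cd).
Qed.

(** The displacement of such a vector lies in L and is orthogonal to U, so both of its coordinates
    are integral. *)
Let analysis_dual (d : 'cV[rat]_m) (a : 'cV_2) : dual_lat G (Bt *m d - P *m a) ->
  mxint (H *m d + (a - Mq *m a)) /\ mxint (c *m d - d).
Proof.
move=> /trivA/lat_mxint iv.
have e : Aq *m (Bt *m d - P *m a) - (Bt *m d - P *m a) =
    P *m (H *m d + (a - Mq *m a)) + Bt *m (c *m d - d).
  exact: block_action_sub AqP AB.
have Pe : P^T *m Gq *m (P *m (H *m d + (a - Mq *m a)) + Bt *m (c *m d - d)) = 0.
  rewrite mulmxDr (mulmxA _ P) (mulmxA _ Bt) (frame_PP fr) (frame_PB fr).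
  by rewrite !mul0mx addr0.
by rewrite e in iv; have := (coP_int cd iv Pe, coB_int cd iv Pe);
  rewrite (coP_comb fr) (coB_comb fr) => -[].
Qed.

Lemma analysis_gram_triv (d : 'cV[rat]_m) : mxint (d^T *m g) -> mxint (c *m d - d).
Proof. by move=> /(dual_lift cd)[a /analysis_dual[]]. Qed.

Lemma analysis_bM : let X := K *m Mq^T in
  bM_pair G z w zeta ups B M (col 0 X) (col 1 X).
Proof.
move=> X; apply/(bM_pairP cd).
rewrite row_mx_cols.
have [MD cg HX] := blocks.
have Xc : X^T *m g *m c = - H := block_dual MD HX.
have [c' c'E] := mxintP analysis_gram_int.
have cu := isometry_unitmx (cusp_nondeg cd) cg c'E.
(* Since [c] is invertible over the integers, X^T g = - H c^-1 is integral. *)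
have iX : mxint (X^T *m g).
  rewrite -[X^T *m g]mulmx1 -[1%:M](ofint1 rat) -(mulmxV cu) (ofintM _ c') -c'E mulmxA Xc.
  by apply: mxintM (ofint_mxint _); apply: mxintN; exact: intH.
split=> // d id; have [a da] := dual_lift cd id; exists a => //.
have [iH ic] := analysis_dual da.
have -> : X^T *m g *m d - (a - Mq *m a) =
    - (H *m d + (a - Mq *m a)) - X^T *m g *m (c *m d - d).
  rewrite (mulmxBr (X^T *m g)) (mulmxA (X^T *m g)) Xc mulNmx.
  by mxabel.
by apply: mxintB; [exact: mxintN|exact: mxintM].
Qed.

End Analysis.

(** L is contained in L^*, so A - 1 maps the standard basis to integral vectors. *)
Lemma integral_isometry (A : 'M[rat]_N) :
  A^T *m Gq *m A = Gq -> (forall v, dual_lat G v -> mxint (A *m v - v)) ->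
  exists A' : 'M[int]_N, [/\ ofint rat A' = A, A' \in unitmx &
    forall v, dual_lat G v -> lat (ofint rat A' *m v - v)].
Proof.
move=> isoA tA; have /mxintP[A' AE] : mxint A.
  apply: mxint_cols => j; rewrite colE -[A *m _](subrK (delta_mx j 0)).
  have id : mxint (delta_mx j 0 : 'cV[rat]_N).
    by apply/mxOverP => k l; rewrite mxE; case: (_ && _).
  apply: mxintD => //; apply: tA; apply/dual_mxint.
  exact: mxintM (mxint_tr id) (ofint_mxint _).
exists A'; split=> //; first exact: isometry_unitmx (cusp_unit cd) isoA AE.
by move=> v /tA; rewrite -AE => /lat_mxint.
Qed.

(** The coordinate t is integral because z and w lie in L. As zeta and ups lie in L^*, the vector
    [Z *m t] can be split off inside L^*. *)
Lemma dual_coord (v : 'cV[rat]_N) : dual_lat G v -> exists a b t,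
  [/\ v = P *m a + Bt *m b + Z *m t, mxint (b^T *m g), mxint t &
      dual_lat G (P *m a + Bt *m b)].
Proof.
move=> dv; have iv : mxint (v^T *m Gq) by exact/dual_mxint.
exists (coP Gq P Z *m v), (coB Gq Bt *m v), (coZ Gq P *m v).
have it : mxint (coZ Gq P *m v).
  rewrite -[coZ _ _ *m v]trmxK; apply: mxint_tr; rewrite (cusp_form_tr cd).
  exact: mxintM iv (ofint_mxint _).
split=> //; first exact: (frame_dec fr v).
  rewrite -gram_sym -trmx_mul -[coB _ _ *m v]mulmxA (cusp_gram cd).
  rewrite mulKVmx ?(cusp_nondeg cd)// (cusp_form_tr cd).
  exact: mxintM iv (cuspB_int cd).
have -> : P *m (coP Gq P Z *m v) + Bt *m (coB Gq Bt *m v) =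
    v - Z *m (coZ Gq P *m v) by apply: (canRL (addrK _)); rewrite -(frame_dec fr).
apply/dual_mxint; rewrite linearB /= mulmxBl; apply: mxintB => //.
by rewrite trmx_mul -mulmxA; apply: mxintM (mxint_tr it) (cuspZ_dual cd).
Qed.

(** * From M and a representative of b_M to an integral isometry *)

Section Synthesis.
Context (M : 'M[int]_2) (X : 'M[rat]_(m, 2)).
Local Notation Mq := (ofint rat M).
Local Notation D := (ofint rat (invmx M)^T).
Local Notation K := (X *m D).
Hypotheses (detM : \det M = 1)
  (SM : forall a : 'cV_2, dual_lat G (P *m a) -> mxint (a - Mq *m a))
  (bX : forall d : 'cV_m, mxint (d^T *m g) ->
    exists2 a, dual_lat G (Bt *m d - P *m a) &
      mxint (X^T *m g *m d - (a - Mq *m a))).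

Let Mu : M \in unitmx. Proof. by rewrite unitmxE detM unitr1. Qed.

Let MD : Mq^T *m D = 1%:M.
Proof.
by rewrite ofint_tr -trmx_mul -ofintM mulVmx// ofint1 trmx1.
Qed.

Let DM : D^T *m Mq = 1%:M.
Proof. by rewrite -[LHS]trmxK trmx_mul trmxK MD trmx1. Qed.

Local Notation E := (D - 1%:M).
Local Notation Y := (- (T *m E)).
(* The displacement of zeta and ups, with its U-component normalized so as to
   be orthogonal to both of them. *)
Local Notation Lm := (P *m Y + Bt *m K + Z *m E).

(** The first quantity is the pairing of the given vector of L^* with the displacement of zeta and
    ups; the second is the U-component of the displacement of that vector. *)
Lemma synth_pairing (a : 'cV_2) (b : 'cV_m) : mxint (b^T *m g) ->
  dual_lat G (P *m a + Bt *m b) ->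
  mxint (a^T *m E + b^T *m g *m K) /\ mxint (Mq *m a - a - X^T *m g *m b).
Proof.
move=> ib dab; have [a0 da0 i0] := bX ib.
(* Both - a and [a0] represent iota^* b, so [P *m (a + a0)] lies in L^*, where the condition
   defining SL(I_{L^*}, I) applies. *)
have iaa : mxint ((a + a0) - Mq *m (a + a0)).
  apply: SM; rewrite (_ : P *m _ = P *m a + Bt *m b - (Bt *m b - P *m a0)).
    apply/dual_mxint; rewrite linearB /= mulmxBl.
    by apply: mxintB; exact/dual_mxint.
  by rewrite mulmxDr; mxabel.
split; last first.
  rewrite (_ : _ - _ = - (((a + a0) - Mq *m (a + a0)) +
    (X^T *m g *m b - (a0 - Mq *m a0)))); first exact: mxintN (mxintD iaa i0).
  by rewrite mulmxDr; mxabel.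
rewrite (_ : _ + _ = ((a + a0) - Mq *m (a + a0))^T *m D +
  (X^T *m g *m b - (a0 - Mq *m a0))^T *m D).
  by apply: mxintD; apply: mxintM (ofint_mxint _); exact: mxint_tr.
have e (x : 'cV[rat]_2) : (x - Mq *m x)^T *m D = x^T *m E.
  by rewrite trmx_sub mulmxBl trmx_mul -mulmxA MD !mulmx1 mulmxBr mulmx1.
rewrite e trmx_sub mulmxBl e trmx_add mulmxDl !trmx_mul trmxK gram_sym.
by rewrite !mulmxA; mxabel.
Qed.

(** By duality it suffices to pair with L^*. The normalization of the U-component cancels the
    pairing with zeta and ups, and [synth_pairing] treats the remaining part. *)
Let Lm_int : mxint Lm.
Proof.
apply: (mxint_double_dual cd) => d /dual_coord[a [b [t [-> ib it dab]]]].
rewrite (frame_form fr) (cusp_gram cd) mulmxN (mulmxA t^T T) subrK.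
by have [] := synth_pairing ib dab.
Qed.

Lemma synth_matrix : exists (J : 'M[rat]_2) (A : 'M[int]_N),
  [/\ ofint rat A = elt Gq P Bt Z Mq 1%:M D (- (X^T *m g)) K J,
     A \in unitmx, forall v, dual_lat G v -> lat (ofint rat A *m v - v) &
     J^T *m D + K^T *m g *m K + D^T *m J + D^T *m T *m D = T].
Proof.
have [l lE] := mxintP Lm_int.
(* Minus the Gram matrix of the displacement. Its diagonal is even because the displacement lies in
   the even lattice L, so r can be chosen integral. *)
pose s := - (l^T *m G *m l).
have sE : ofint rat s = - (Lm^T *m Gq *m Lm).
  by rewrite lE -ofint_tr -!ofintM /ofint map_mxN.
have [|i|r rE] := @symmetric_part_of_even s.
- by rewrite /s linearN /= !trmx_mul trmxK (cusp_even cd).1 mulmxA.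
- rewrite mxE -[G]ofint_int bilformE rpredN.
  exact: (cusp_even cd).2.
pose J := Y + Mq *m ofint rat r.
have JE : J^T *m D + K^T *m g *m K + D^T *m J + D^T *m T *m D = T.
  apply: synth_gram; [exact: (cusp_form_tr cd)|exact: MD|].
  rewrite -(cusp_gram cd) -(frame_form fr) -sE -rE.
  by rewrite -ofint_tr /ofint map_mxD.
pose A := elt Gq P Bt Z Mq 1%:M D (- (X^T *m g)) K J.
have AP : A *m P = P *m Mq by exact: elt_P.
have AB : A *m Bt = P *m - (X^T *m g) + Bt *m 1%:M by exact: elt_B.
have AZ : A *m Z = P *m J + Bt *m K + Z *m D by exact: elt_Z.
have isoA : A^T *m Gq *m A = Gq.
  apply: (isometry_of_blocks fr AP AB AZ); rewrite ?(cusp_gram cd).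
  - exact: MD.
  - by rewrite trmx1 mul1mx mulmx1.
  - by rewrite mulmx1 trmx_mul mulmxN -mulmxA addNr.
  - exact: JE.
have [v dv|A' [A'E uA tA]] := integral_isometry isoA.
  have [a [b [t [-> ib it dab]]]] := dual_coord dv.
  have [_ iMa] := synth_pairing ib dab.
  rewrite (synth_action _ _ _ AP AB AZ (erefl J)).
  apply: mxintD; first apply: mxintD.
  - exact: mxintM Lm_int it.
  - apply: mxintM (ofint_mxint _) _; apply: mxintM it.
    exact: mxintM (ofint_mxint _) (ofint_mxint _).
  by apply: mxintM (ofint_mxint _) _; rewrite mulNmx.
by exists J, A'.
Qed.

End Synthesis.

Lemma Lambda_matrix (c : 'M[int]_m) :
  (ofint rat c)^T *m g *m ofint rat c = g ->
  (forall v, dual_lat (gramLambda G B) v -> lat (ofint rat c *m v - v)) ->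
  exists A : 'M[int]_N,
  [/\ ofint rat A = elt Gq P Bt Z 1%:M (ofint rat c) 1%:M 0 0 0,
     A \in unitmx & forall v, dual_lat G v -> lat (ofint rat A *m v - v)].
Proof.
move=> isoc tc; pose A := elt Gq P Bt Z 1%:M (ofint rat c) 1%:M 0 0 0.
have AP : A *m P = P *m 1%:M by exact: elt_P.
have AB : A *m Bt = P *m 0 + Bt *m ofint rat c by exact: elt_B.
have AZ : A *m Z = P *m 0 + Bt *m 0 + Z *m 1%:M by exact: elt_Z.
have isoA : A^T *m Gq *m A = Gq.
  apply: (isometry_of_blocks fr AP AB AZ); rewrite ?(cusp_gram cd)//.
  - by rewrite trmx1 mul1mx.
  - by rewrite mulmx0 trmx0 !mul0mx addr0.
  by rewrite !(trmx0, mul0mx, mulmx0, trmx1, mul1mx, mulmx1, add0r).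
have [v dv|A' [A'E uA tA]] := integral_isometry isoA; last by exists A'.
have [a [b [t [-> ib it dab]]]] := dual_coord dv.
rewrite (_ : _ - _ = Bt *m (ofint rat c *m b - b)).
  by apply: mxintM (cuspB_int cd) _; apply/lat_mxint/tc/dual_mxint.
rewrite 2!(mulmxDr A) !(mulmxA A) AP AB AZ !(mulmx0, mulmx1, add0r).
by rewrite mulmxBr mulmxA; mxabel.
Qed.

End Elements.

(** * Connected components *)

Section Connectedness.

Lemma component_image (S T : topologicalType) (f : S -> T) (A : set S)
    (A' : set T) x y : continuous f -> (forall s, A s -> A' (f s)) ->
  connected_component A x y -> connected_component A' (f x) (f y).
Proof.
move=> cf fA [C [Cx CA cC] Cy]; exists (f @` C); last by exists y.
split; first by exists x.
  by move=> _ [s Cs <-]; exact/fA/CA.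
by apply: connected_continuous_connected => //; exact: continuous_subspaceT.
Qed.

Lemma component_path (R : realType) (T : topologicalType) (f : R -> T)
    (A : set T) a b : continuous f -> (forall t, A (f t)) ->
  connected_component A (f a) (f b).
Proof.
move=> cf fA; exists (range f); last by exists b.
split; first by exists a.
  by move=> _ [s _ <-].
apply: connected_continuous_connected; last exact: continuous_subspaceT.
exact/connected_intervalP.
Qed.

Context {R : realType} {S : topologicalType}.

(** Continuity is stated entrywise, so that matrix products reduce to sums of products of scalar
    functions. *)
Definition mxcont p q (f : S -> 'M[R]_(p, q)) :=
  forall i j, continuous (fun x => f x i j).

Lemma mxcont_continuous p q (f : S -> 'M[R]_(p, q)) : mxcont f -> continuous f.
Proof.
move=> cf x V [P fP sPV].
have : \forall y \near x, forall ij, P ij.1 ij.2 (f y ij.1 ij.2).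
  by apply: filter_forall => -[i j] /=; exact: cf (fP i j).
by apply: filterS => y Py; apply: sPV => i j; exact: (Py (i, j)).
Qed.

Lemma mxcont_cst p q (A : 'M[R]_(p, q)) : mxcont (fun=> A).
Proof. by move=> i j x; exact: cvg_cst. Qed.

Lemma mxcontD p q (f h : S -> 'M[R]_(p, q)) :
  mxcont f -> mxcont h -> mxcont (fun x => f x + h x).
Proof.
move=> cf ch i j x; under eq_fun do rewrite mxE.
by apply: continuousD; [exact: cf|exact: ch].
Qed.

Lemma mxcontN p q (f : S -> 'M[R]_(p, q)) : mxcont f -> mxcont (fun x => - f x).
Proof.
move=> cf i j x; under eq_fun do rewrite mxE.
by apply: continuousN; exact: cf.
Qed.

Lemma mxcontB p q (f h : S -> 'M[R]_(p, q)) :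
  mxcont f -> mxcont h -> mxcont (fun x => f x - h x).
Proof. by move=> cf ch; apply: mxcontD => //; exact: mxcontN. Qed.

Lemma mxcont_tr p q (f : S -> 'M[R]_(p, q)) : mxcont f -> mxcont (fun x => (f x)^T).
Proof. by move=> cf i j x; under eq_fun do rewrite mxE; exact: cf. Qed.

Lemma mxcontZ p q (k : S -> R) (f : S -> 'M[R]_(p, q)) :
  continuous k -> mxcont f -> mxcont (fun x => k x *: f x).
Proof.
move=> ck cf i j x; under eq_fun do rewrite mxE.
by apply: continuousM; [exact: ck|exact: cf].
Qed.

Lemma continuous_bigsum (K : Type) (s : seq K) (f : K -> S -> R) :
  (forall k, continuous (f k)) -> continuous (fun x => \sum_(k <- s) f k x).
Proof.
move=> cf x; elim: s => [|k s IH].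
  by under eq_fun do rewrite big_nil; exact: cvg_cst.
by under eq_fun do rewrite big_cons; apply: continuousD => //; exact: cf.
Qed.

Lemma mxcontM p q r (f : S -> 'M[R]_(p, q)) (h : S -> 'M[R]_(q, r)) :
  mxcont f -> mxcont h -> mxcont (fun x => f x *m h x).
Proof.
move=> cf ch i j; under eq_fun do rewrite mxE.
apply: continuous_bigsum => k x.
by apply: continuousM; [exact: cf|exact: ch].
Qed.

End Connectedness.

Lemma mxcont_id (R : realType) p q : mxcont (fun A : 'M[R]_(p, q) => A).
Proof. by move=> i j; exact: coord_continuous. Qed.

(** * Elementary factorization and the inverse transpose in SL_2 *)

Section SL2.
Context {K : fieldType}.

Definition upper2 (x : K) : 'M[K]_2 := 1%:M + x *: delta_mx 0 1.
Definition lower2 (x : K) : 'M[K]_2 := 1%:M + x *: delta_mx 1 0.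

Lemma det_mx2 (M : 'M[K]_2) : \det M = M 0 0 * M 1 1 - M 0 1 * M 1 0.
Proof.
rewrite (expand_det_row _ 0) !big_ord_recl big_ord0 addr0 /cofactor !det_mx11.
rewrite !mxE /= expr0 expr1 mul1r mulN1r mulrN.
by congr (M _ _ * M _ _ - M _ _ * M _ _); apply: val_inj.
Qed.

Lemma mul_mx2 (A C : 'M[K]_2) i j :
  (A *m C) i j = A i 0 * C 0 j + A i 1 * C 1 j.
Proof.
rewrite mxE !big_ord_recl big_ord0 addr0.
by congr (A _ _ * C _ _ + A _ _ * C _ _); apply: val_inj.
Qed.

(** Four elementary factors with independent parameters: scaling all parameters to zero then joins M
    to the identity inside SL_2. *)
Lemma SL2_factor (M : 'M[K]_2) : \det M = 1 -> exists x y u v,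
  M = upper2 x *m lower2 y *m upper2 u *m lower2 v.
Proof.
rewrite det_mx2 => dM.
have [c0|c0] := eqVneq (M 1 0) 0.
  have d0 : M 1 1 != 0.
    apply/eqP => d0; move/eqP: dM; rewrite c0 d0 !mulr0 subr0 eq_sym.
    by rewrite oner_eq0.
  have aE : M 0 0 = (M 1 1)^-1.
    by rewrite -[LHS](mulfK d0) -[X in X / _](subr0) -(mulr0 (M 0 1)) -c0 dM mul1r.
  (* Multiplication by [lower2 1] on the right makes the lower left entry equal to [M 1 1], which is
     nonzero; these are the generic parameters for that product. *)
  exists ((M 0 0 + M 0 1 - 1) / M 1 1), (M 1 1), ((M 1 1 - 1) / M 1 1), (-1).
  by apply: mx2P; rewrite !mul_mx2 !mxE /= ?c0 ?aE /=; field.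
have bE : M 0 1 = (M 0 0 * M 1 1 - 1) / M 1 0.
  by rewrite -dM opprB addrC subrK mulfK.
exists ((M 0 0 - 1) / M 1 0), (M 1 0), ((M 1 1 - 1) / M 1 0), 0.
by apply: mx2P; rewrite !mul_mx2 !mxE /= ?bE /=; field.
Qed.

Definition symp2 : 'M[K]_2 := delta_mx 0 1 - delta_mx 1 0.

(** In determinant 1 the inverse transpose is a conjugate of M, hence polynomial in its entries and
    continuous along a path. *)
Lemma symp2_dual (M : 'M[K]_2) : \det M = 1 ->
  M^T *m (symp2 *m M *m symp2^T) = 1%:M.
Proof.
rewrite det_mx2 => dM.
apply: mx2P; rewrite !mul_mx2 !mxE /= ?mulr1n ?mulr0n;
  [rewrite -[RHS]dM|..|rewrite -[RHS]dM]; ring.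
Qed.

End SL2.

Lemma continuous_det2 (R : realType) (S : topologicalType) (f : S -> 'M[R]_2) :
  mxcont f -> continuous (fun x => \det (f x)).
Proof.
move=> cf x.
have -> : (fun x => \det (f x)) =
    (fun x => f x 0 0 * f x 1 1 - f x 0 1 * f x 1 0).
  by apply/funext => y; rewrite det_mx2.
apply: (@continuousD _ _ _ (fun x => f x 0 0 * f x 1 1)
  (fun x => - (f x 0 1 * f x 1 0))).
  by apply: continuousM; exact: cf.
by apply: continuousN; apply: continuousM; exact: cf.
Qed.

Lemma SL2_path (R : realType) (M : 'M[R]_2) : \det M = 1 ->
  exists f : R -> 'M[R]_2,
    [/\ mxcont f, f 0 = 1%:M, f 1 = M & forall t, \det (f t) = 1].
Proof.
move=> /SL2_factor[x [y [u [v ->]]]].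
exists (fun t => upper2 (t * x) *m lower2 (t * y) *m upper2 (t * u) *m lower2 (t * v)).
have cZ (a : R) p q (A : 'M[R]_(p, q)) : mxcont (fun t : R => (t * a) *: A).
  apply: mxcontZ; last exact: mxcont_cst.
  move=> t.
  by apply: continuousM; [exact: cvg_id|exact: cvg_cst].
split.
- by do 3?apply: mxcontM; apply: mxcontD; (exact: mxcont_cst || exact: cZ).
- by rewrite /upper2 /lower2 !mul0r !scale0r !addr0 !mulmx1.
- by rewrite !mul1r.
by move=> t; rewrite !det_mulmx !det_mx2 !mxE /=; ring.
Qed.

Lemma component_mono (T : topologicalType) (A A' : set T) x y :
  A `<=` A' -> connected_component A x y -> connected_component A' x y.
Proof.
by move=> AA' [C [Cx CA cC] Cy]; exists C => //; split=> // t /CA/AA'.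
Qed.

Lemma connected_gt0 (R : realType) (T : topologicalType) (h : T -> R)
    (A : set T) x y : continuous h -> (forall t, A t -> h t != 0) ->
  connected_component A x y -> 0 < h x -> 0 < h y.
Proof.
move=> ch h0 Axy hx.
have : connected_component [set r | r != 0] (h x) (h y).
  exact: component_image Axy.
move=> [C [Cx C0 /connected_intervalP iC] Cy].
rewrite lt_neqAle eq_sym C0//= leNgt; apply/negP => hy.
by have /C0 /= := iC _ _ Cy Cx 0 (introT andP (conj (ltW hy) (ltW hx)));
  rewrite eqxx.
Qed.

Lemma int_unit_pos (x y : int) : x * y = 1 -> 0 < x -> x = 1.
Proof.
move=> /(congr1 absz); rewrite abszM => /eqP; rewrite muln_eq1 => /andP[/eqP x1 _].
by move=> x0; rewrite -[x]gtz0_abs// x1.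
Qed.

Lemma continuous_id (T : topologicalType) : continuous (fun x : T => x).
Proof. by move=> x; exact: cvg_id. Qed.

Lemma trmx_sandwich (K : comPzRingType) p q (S : 'M[K]_p) (D : 'M[K]_(p, q)) :
  S^T = S -> (D^T *m S *m D)^T = D^T *m S *m D.
Proof. by move=> Ss; rewrite !trmx_mul trmxK Ss mulmxA. Qed.

(** * Identity components: Gamma_{L,I}, SL(I_{L^*}, I) and Gamma_Lambda *)

Section Groups.
Context (R : realType) (N m : nat) (G : 'M[int]_N) (I : set 'cV[int]_N)
  (z w : 'cV[int]_N) (zeta ups : 'cV[rat]_N) (B : 'M[int]_(N, m)).
Hypothesis cd : cusp_data G I z w zeta ups B.

Local Notation Gq := (ofint rat G).
Local Notation P := (ofint rat (basU z w)).
Local Notation g := (ofint rat (gramLambda G B)).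
Local Notation Z := (cuspZ zeta ups).
Local Notation Bt := (cuspB G z w zeta ups B).

Lemma frame_ratr (K : numFieldType) :
  frame (ofint K G) (ofint K (basU z w)) (map_mx ratr Bt) (map_mx ratr Z).
Proof. by rewrite -!(ratr_ofint K); exact: (frame_map _ (cusp_frame cd)). Qed.

Lemma gram_ratr (K : numFieldType) :
  (map_mx ratr Bt)^T *m ofint K G *m map_mx ratr Bt = ofint K (gramLambda G B).
Proof.
by rewrite -!(ratr_ofint K) map_trmx -!map_mxM (cusp_gram cd).
Qed.

Local Notation GR := (ofint R G).
Local Notation PR := (ofint R (basU z w)).
Local Notation ZR := (map_mx ratr Z : 'M[R]_(N, 2)).
Local Notation BR := (map_mx ratr Bt : 'M[R]_(N, m)).
Local Notation gR := (ofint R (gramLambda G B)).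
Let frR : frame GR PR BR ZR := frame_ratr R.

Lemma map_ratr_inj (K : numFieldType) p q :
  injective (map_mx ratr : 'M[rat]_(p, q) -> 'M[K]_(p, q)).
Proof. by apply: map_mx_inj; exact: fmorph_inj. Qed.

Lemma parabolicP (C : 'M[R]_N) : parabolic G z w C <->
  orthogonal_group G C /\ exists2 M, M \in unitmx & C *m PR = PR *m M.
Proof.
split=> [[oC CU]|[oC [M uM CP]]]; split=> //; last first.
  apply/seteqP; split=> [_ [_ [c _ <-] <-]|_ [c _ <-]].
    by exists (M *m c) => //; rewrite !mulmxA CP.
  exists (PR *m (invmx M *m c)); first by exists (invmx M *m c).
  by rewrite !mulmxA CP -(mulmxA PR) mulmxV// mulmx1.
have span (X : 'M[R]_(N, 2)) : (forall j, spaceU z w (col j X)) ->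
    exists M, X = PR *m M.
  move=> sX; have [[a _ a0] [b _ b1]] := (sX 0, sX 1).
  exists (row_mx a b); apply: pairmxE; rewrite -?a0 -?b1 colE -mulmxA -colE.
    by rewrite col0_pair.
  by rewrite col1_pair.
have [j|M CP] := span (C *m PR).
  rewrite -CU colE -mulmxA; exists (PR *m delta_mx j 0) => //.
  by exists (delta_mx j 0).
exists M => //.
have [c0 cE0] : exists c, C *m PR *m c = PR *m delta_mx 0 (0 : 'I_1).
  have : spaceU z w (PR *m delta_mx 0 (0 : 'I_1)) by exists (delta_mx 0 0).
  by rewrite -CU => -[_ [c _ <-] <-]; exists c; rewrite mulmxA.
have [c1 cE1] : exists c, C *m PR *m c = PR *m delta_mx 1 (0 : 'I_1).
  have : spaceU z w (PR *m delta_mx 1 (0 : 'I_1)) by exists (delta_mx 1 0).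
  by rewrite -CU => -[_ [c _ <-] <-]; exists c; rewrite mulmxA.
have : M *m row_mx c0 c1 = 1%:M.
  have e : PR *m (M *m row_mx c0 c1) = PR *m 1%:M.
    rewrite mulmxA -CP; apply: pairmxE; rewrite !colE -!mulmxA -!colE.
      by rewrite col0_pair mulmxA cE0 colE mul1mx.
    by rewrite col1_pair mulmxA cE1 colE mul1mx.
  by have /(congr1 (mulmx (coP GR PR ZR))) := e; rewrite !mulmxA (coPP frR) !mul1mx.
by move=> /mulmx1_unit[].
Qed.

Lemma orthogonal_int (A : 'M[int]_N) : orthogonal_group G (ofint R A) ->
  (ofint rat A)^T *m Gq *m ofint rat A = Gq.
Proof.
rewrite /orthogonal_group /= -ofint_tr -!ofintM => /(@ofint_inj R) e.
by rewrite -ofint_tr -!ofintM e.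
Qed.

(** M is integral because its entries are pairings of zeta and ups with vectors of L, and so is its
    inverse, computed from [invmx A]. The identity component fixes the sign of the determinant. *)
Lemma GammaLI_SL2 (A : 'M[int]_N) : GammaLI R G z w A ->
  exists2 M : 'M[int]_2, \det M = 1 & A *m basU z w = basU z w *m M.
Proof.
move=> [cA [uA _ tA]].
have /parabolicP[oA [MR uMR APR]] := connected_component_sub cA.
(* [h] reads off the action on U continuously, and its determinant has no zero on the parabolic
   group. *)
pose h (C : 'M[R]_N) := coP GR PR ZR *m (C *m PR).
have hM C M : C *m PR = PR *m M -> h C = M.
  by move=> e; rewrite /h e mulmxA (coPP frR) mul1mx.
have hA : 0 < \det (h (ofint R A)).
  apply: (@connected_gt0 R _ (fun C => \det (h C)) (parabolic G z w) 1%:M) => //.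
  - have ch : mxcont h.
      apply: mxcontM; first exact: mxcont_cst.
      by apply: mxcontM; [exact: mxcont_id|exact: mxcont_cst].
    exact: continuous_det2.
  - move=> C /parabolicP[_ [M uM /hM ->]].
    by move: uM; rewrite unitmxE unitfE.
  by rewrite (hM _ 1%:M) ?det1 ?ltr01// mul1mx mulmx1.
have APq : ofint rat A *m P = P *m (Z^T *m Gq *m (ofint rat A *m P)).
  apply: (@map_ratr_inj R); rewrite !map_mxM !ratr_ofint.
  rewrite [in LHS]APR (mulmxA _ (ofint R A)) -mulmxA APR -map_trmx.
  by rewrite (mulmxA _ PR MR) (frame_ZP frR) mul1mx.
have /mxintP[M ME] : mxint (Z^T *m Gq *m (ofint rat A *m P)).
  apply: mxintM (cuspZ_dual cd) _.
  exact: mxintM (ofint_mxint _) (ofint_mxint _).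
have AP : A *m basU z w = basU z w *m M.
  by apply: (@ofint_inj rat); rewrite !ofintM APq ME.
exists M => //.
have hAM : h (ofint R A) = ofint R M by apply: hM; rewrite -!ofintM AP.
have M0 : 0 < \det M by move: hA; rewrite hAM /ofint det_map_mx ltr0z.
have uMq : ofint rat M \in unitmx.
  by rewrite unitmxE unitfE /ofint det_map_mx intr_eq0 gt_eqF.
have iMq : invmx (ofint rat M) = Z^T *m Gq *m (ofint rat (invmx A) *m P).
  have e : P = ofint rat (invmx A) *m P *m ofint rat M.
    by rewrite -mulmxA -ofintM -AP ofintM mulmxA -ofintM mulVmx// ofint1 mul1mx.
  rewrite -[RHS](mulmxK uMq) -(mulmxA (Z^T *m Gq)) -e (cuspZP cd).
  by rewrite mul1mx.
have /mxintP[M' M'E] : mxint (invmx (ofint rat M)).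
  rewrite iMq; apply: mxintM (cuspZ_dual cd) _.
  exact: mxintM (ofint_mxint _) (ofint_mxint _).
have : M *m M' = 1%:M.
  by apply: (@ofint_inj rat); rewrite ofintM -M'E mulmxV// ofint1.
by move=> /(congr1 determinant); rewrite det_mulmx det1 => /int_unit_pos; exact.
Qed.

Lemma GammaLI_iso (A : 'M[int]_N) : GammaLI R G z w A ->
  (ofint rat A)^T *m Gq *m ofint rat A = Gq.
Proof.
by move=> [cA _]; have [oA _] := connected_component_sub cA; exact: orthogonal_int.
Qed.

Lemma GammaLI_Lambda (A : 'M[int]_N) : GammaLI R G z w A ->
  exists2 c : 'M[int]_m, disc_kernel R (gramLambda G B) c &
    ofint rat c = coB Gq Bt *m (ofint rat A *m Bt).
Proof.
move=> LA; have isoA := GammaLI_iso LA; have [M dM AP] := GammaLI_SL2 LA.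
have [cA [uA _ tA]] := LA.
have /mxintP[c cE] := analysis_gram_int cd isoA AP dM.
exists c => //; split.
- apply: (isometry_unitmx (cusp_nondeg cd) _ cE).
  have := gram_isometry (cusp_frame cd) isoA (M := ofint rat M).
  rewrite (cusp_gram cd); apply; first by rewrite -!ofintM AP.
  by rewrite unitmxE /ofint det_map_mx dM rmorph1 unitr1.
(* Passing to the action on W is continuous and maps the parabolic group to the orthogonal group of
   W, so it preserves identity components. *)
- pose f (C : 'M[R]_N) := coB GR BR *m (C *m BR).
  have f1 : f 1%:M = 1%:M by rewrite /f mul1mx (coBB frR).
  have fA : f (ofint R A) = ofint R c.
    rewrite /f -(ratr_ofint R G) -(ratr_ofint R A) -(ratr_ofint R c).
    by rewrite coB_map -!map_mxM cE.
  rewrite /SOplus -f1 -fA.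
  apply: component_image cA.
    apply: mxcont_continuous; apply: mxcontM; first exact: mxcont_cst.
    by apply: mxcontM; [exact: mxcont_id|exact: mxcont_cst].
  move=> C /parabolicP[oC [M' uM' CP]].
  rewrite /orthogonal_group /= -gram_ratr.
  exact: (gram_isometry frR oC CP uM').
- move=> v /dual_mxint iv; rewrite -cE.
  exact/lat_mxint/(analysis_gram_triv cd isoA AP dM tA).
Qed.

Lemma Lambda_lift (c : 'M[int]_m) : disc_kernel R (gramLambda G B) c ->
  exists2 A : 'M[int]_N, GammaLI R G z w A &
    ofint rat A = elt Gq P Bt Z 1%:M (ofint rat c) 1%:M 0 0 0.
Proof.
move=> [uc cc tc].
have oc : (ofint rat c)^T *m g *m ofint rat c = g.
  have := connected_component_sub cc; rewrite /orthogonal_group /=.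
  by rewrite -!ofint_tr -!ofintM => /(@ofint_inj R) ->.
have [A [AE uA tA]] := Lambda_matrix cd oc tc; exists A => //.
pose f (C : 'M[R]_m) := elt GR PR BR ZR 1%:M C 1%:M 0 0 0.
have f1 : f 1%:M = 1%:M.
  apply: (frame_ext frR); rewrite ?(elt_P frR) ?(elt_B frR) ?(elt_Z frR);
    by rewrite !(mulmx0, mulmx1, mul1mx, add0r).
have fc : f (ofint R c) = ofint R A.
  rewrite -(ratr_ofint R A) AE -elt_map !(ratr_ofint R) map_mx1.
  by rewrite !map_mx0.
have ccA : connected_component (parabolic G z w) 1%:M (ofint R A).
  rewrite -f1 -fc; apply: component_image cc.
    apply: mxcont_continuous; rewrite /f /elt.
    apply: mxcontD; last exact: mxcont_cst.
    apply: mxcontD; first exact: mxcont_cst.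
    apply: mxcontM; last exact: mxcont_cst.
    apply: mxcontD; first exact: mxcont_cst.
    by apply: mxcontM; [exact: mxcont_cst|exact: mxcont_id].
  move=> C oC; apply/parabolicP; split; last first.
    by exists 1%:M; rewrite ?unitmx1// (elt_P frR).
  apply: (isometry_of_blocks frR (elt_P frR _ _ _ _ _ _) (elt_B frR _ _ _ _ _ _)
    (elt_Z frR _ _ _ _ _ _)); rewrite ?gram_ratr.
  - by rewrite trmx1 mul1mx.
  - exact: oC.
  - by rewrite mulmx0 trmx0 !mul0mx addr0.
  by rewrite !(trmx0, mul0mx, mulmx0, trmx1, mul1mx, mulmx1, add0r).
split=> //; split=> //.
by apply: component_mono ccA => C /parabolicP[].
Qed.

(** A path from 1 to A: M runs along a path in SL_2(R), the blocks [H] and [K] are scaled by t, and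
    the U-component of the images of zeta and ups is adjusted so that every point of the path is an
    isometry. *)
Lemma synth_GammaLI (M : 'M[int]_2) (X : 'M[rat]_(m, 2)) (J : 'M[rat]_2)
    (A : 'M[int]_N) :
  let D := ofint rat (invmx M)^T in let T := Z^T *m Gq *m Z in
  \det M = 1 ->
  ofint rat A = elt Gq P Bt Z (ofint rat M) 1%:M D (- (X^T *m g)) (X *m D) J ->
  A \in unitmx -> (forall v, dual_lat G v -> lat (ofint rat A *m v - v)) ->
  J^T *m D + (X *m D)^T *m g *m (X *m D) + D^T *m J + D^T *m T *m D = T ->
  GammaLI R G z w A.
Proof.
move=> D T dM AE uA tA JE.
pose MR := ofint R M; pose XR := map_mx ratr X : 'M[R]_(m, 2).
pose J1 := map_mx ratr J : 'M[R]_2; pose D1 := ofint R (invmx M)^T.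
pose TR := ZR^T *m GR *m ZR.
have uM : M \in unitmx by rewrite unitmxE dM unitr1.
have MD1 : MR^T *m D1 = 1%:M.
  by rewrite /D1 ofint_tr -trmx_mul -ofintM mulVmx// ofint1 trmx1.
have MD1' : MR *m D1^T = 1%:M.
  by apply: mulmx1C; rewrite -[LHS]trmxK trmx_mul trmxK MD1 trmx1.
have JE1 : J1^T *m D1 + (XR *m D1)^T *m gR *m (XR *m D1) + D1^T *m J1 +
    D1^T *m TR *m D1 = TR.
  have := congr1 (map_mx ratr : 'M[rat]_2 -> 'M[R]_2) JE.
  by rewrite !(map_mxD, map_mxM) -!map_trmx !(map_mxM, ratr_ofint).
have [f [cf f0 f1 fdet]] : exists f : R -> 'M[R]_2,
    [/\ mxcont f, f 0 = 1%:M, f 1 = MR & forall t, \det (f t) = 1].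
  by apply: SL2_path; rewrite /MR /ofint det_map_mx dM rmorph1.
pose Dt t := symp2 *m f t *m symp2^T.
have cD : mxcont Dt.
  apply: mxcontM; last exact: mxcont_cst.
  by apply: mxcontM => //; exact: mxcont_cst.
have MD t : (f t)^T *m Dt t = 1%:M by exact: symp2_dual.
have DM t : (Dt t)^T *m f t = 1%:M by rewrite -[LHS]trmxK trmx_mul trmxK MD trmx1.
have D0 : Dt 0 = 1%:M by have := MD 0; rewrite f0 trmx1 mul1mx.
have DtE : Dt 1 = D1.
  rewrite -[LHS]mul1mx -[1%:M]trmx1 -MD1' trmx_mul trmxK -mulmxA -f1 MD mulmx1.
  by [].
pose Kt t := t *: (XR *m Dt t).
(* Writing the U-component as [f t *m j t], the isometry condition becomes that j + j^T equals this
   symmetric matrix. *)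
pose Q t := TR - (Dt t)^T *m TR *m Dt t - (Kt t)^T *m gR *m Kt t.
have symT : TR^T = TR by exact: (frame_tr frR).
have symg : gR^T = gR by rewrite -gram_ratr; exact: (frame_tr frR).
have Qs t : (Q t)^T = Q t.
  by rewrite /Q !trmx_sub symT (trmx_sandwich _ symT) (trmx_sandwich _ symg).
(* Over the reals half of [Q t] is a continuous solution, but its value at 1 need not be the one
   belonging to A. *)
pose h t := 2^-1 *: Q t.
have hs t : (h t)^T = h t by rewrite /h linearZ /= Qs.
have hh t : h t + h t = Q t.
  have half : 2^-1 + 2^-1 = 1 :> R by field.
  by rewrite /h -scalerDl half scale1r.
have cK : mxcont Kt.
  apply: mxcontZ; first exact: continuous_id.
  by apply: mxcontM => //; exact: mxcont_cst.
have cQ : mxcont Q.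
  apply: mxcontB; first apply: mxcontB; first exact: mxcont_cst.
    apply: mxcontM => //; apply: mxcontM; last exact: mxcont_cst.
    exact: mxcont_tr.
  apply: mxcontM => //; apply: mxcontM; last exact: mxcont_cst.
  exact: mxcont_tr.
have ch : mxcont h by apply: mxcontZ => // x; exact: cvg_cst.
(* Two solutions differ by an antisymmetric matrix. Adding t times this difference keeps the
   condition and reaches A at t = 1. *)
pose S := D1^T *m J1 - h 1.
have SS : S + S^T = 0.
  have K1 : Kt 1 = XR *m D1 by rewrite /Kt scale1r DtE.
  have e : D1^T *m J1 + J1^T *m D1 = Q 1.
    by rewrite /Q K1 DtE -{1}JE1; mxabel.
  rewrite /S trmx_sub hs trmx_mul trmxK -(subrr (Q 1)) -{1}e -(hh 1).
  by mxabel.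
pose j t := h t + t *: S.
have jj t : j t + (j t)^T = Q t.
  have -> : j t + (j t)^T = (h t + h t) + t *: (S + S^T).
    by rewrite /j trmx_add hs [(t *: S)^T]linearZ /= [in RHS]scalerDr; mxabel.
  by rewrite SS scaler0 addr0 hh.
pose F t := elt GR PR BR ZR (f t) 1%:M (Dt t) (t *: - (XR^T *m gR)) (Kt t)
  (f t *m j t).
have F0 : F 0 = 1%:M.
  have Q0 : Q 0 = 0.
    by rewrite /Q /Kt scale0r D0 trmx1 mul1mx mulmx1 !mulmx0 subrr subr0.
  have j0 : j 0 = 0 by rewrite /j /h Q0 scaler0 scale0r addr0.
  apply: (frame_ext frR); rewrite ?(elt_P frR) ?(elt_B frR) ?(elt_Z frR) ?mul1mx.
  - by rewrite f0 mulmx1.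
  - by rewrite scale0r mulmx0 mulmx1 add0r.
  by rewrite j0 /Kt scale0r D0 !(mulmx0, mulmx1, add0r).
have F1 : F 1 = ofint R A.
  rewrite -(ratr_ofint R A) AE -elt_map /F /Kt /j !scale1r DtE f1.
  rewrite [h 1 + _]addrC subrK mulmxA MD1' mul1mx map_mxN !map_mxM.
  by rewrite -!map_trmx !(ratr_ofint R) map_mx1.
have ccA : connected_component (parabolic G z w) 1%:M (ofint R A).
  rewrite -F0 -F1; apply: component_path.
    apply: mxcont_continuous; rewrite /F /elt.
    have cc := @mxcont_cst R R.
    apply: mxcontD; first apply: mxcontD.
    - by apply: mxcontM => //; apply: mxcontM.
    - apply: mxcontM => //; apply: mxcontD => //; apply: mxcontM => //.
      by apply: mxcontZ => //; exact: continuous_id.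
    apply: mxcontM => //; apply: mxcontD; last by apply: mxcontM.
    apply: mxcontD; last by apply: mxcontM.
    apply: mxcontM => //; apply: mxcontM => //; apply: mxcontD => //.
    by apply: mxcontZ => //; exact: continuous_id.
  move=> t; apply/parabolicP; split; last first.
    by exists (f t); rewrite ?(elt_P frR)// unitmxE fdet unitr1.
  apply: (isometry_of_blocks frR (elt_P frR _ _ _ _ _ _) (elt_B frR _ _ _ _ _ _)
    (elt_Z frR _ _ _ _ _ _)); rewrite ?gram_ratr.
  - exact: MD.
  - by rewrite trmx1 mul1mx mulmx1.
  - rewrite mulmx1 /Kt [(t *: _)^T]linearZ /= (trmx_mul XR) -scalemxAl -scalemxAr mulmxN.
    by rewrite mulmxA scalerN addNr.
  rewrite (trmx_mul (f t)) -(mulmxA (j t)^T) MD mulmx1 (mulmxA (Dt t)^T (f t)) DM mul1mx.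
  rewrite -[RHS](subrK ((Dt t)^T *m TR *m Dt t)).
  rewrite -[X in _ = X + _](subrK ((Kt t)^T *m gR *m Kt t)) -/(Q t) -jj.
  by mxabel.
split=> //; split=> //.
by apply: component_mono ccA => C /parabolicP[].
Qed.

End Groups.

(** * Action on the affine bundle *)

Section Action.
Context (R : realType) (N m : nat) (G : 'M[int]_N) (I : set 'cV[int]_N)
  (z w : 'cV[int]_N) (zeta ups : 'cV[rat]_N) (B : 'M[int]_(N, m)).
Hypothesis cd : cusp_data G I z w zeta ups B.

Local Notation C := (R[i]).
Local Notation Gq := (ofint rat G).
Local Notation P := (ofint rat (basU z w)).
Local Notation g := (ofint rat (gramLambda G B)).
Local Notation Z := (cuspZ zeta ups).
Local Notation Bt := (cuspB G z w zeta ups B).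
Local Notation GC := (ofint C G).
Local Notation PC := (ofint C (basU z w)).
Local Notation ZC := (map_mx ratr Z : 'M[C]_(N, 2)).
Local Notation BC := (map_mx ratr Bt : 'M[C]_(N, m)).
Let fr : frame Gq P Bt Z := cusp_frame cd.
Let frC : frame GC PC BC ZC := frame_ratr cd C.

(* In the coordinates of the frame, A acts on V/U through M, c and the
   off-diagonal block X M^{-*}, where X has columns lam and mu. *)
Definition acts (A : 'M[int]_N) (M : 'M[int]_2) (c : 'M[int]_m)
    (X : 'M[rat]_(m, 2)) : Prop :=
  let D := ofint rat (invmx M)^T in
  coZ Gq P *m ofint rat A = D *m coZ Gq P /\
  coB Gq Bt *m ofint rat A = ofint rat c *m coB Gq Bt + X *m D *m coZ Gq P.

(** Modulo U the blocks [H] and [J] disappear; M survives through its inverse transpose. *)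
Lemma elt_acts (A : 'M[int]_N) (M : 'M[int]_2) (c : 'M[int]_m)
    (H : 'M[rat]_(2, m)) (X : 'M[rat]_(m, 2)) (J : 'M[rat]_2) :
  let D := ofint rat (invmx M)^T in
  ofint rat A = elt Gq P Bt Z (ofint rat M) (ofint rat c) D H (X *m D) J ->
  acts A M c X.
Proof.
move=> D AE; rewrite /acts AE -/D.
have ZE : coZ Gq P *m Z = 1%:M := coZZ fr.
have ZP : coZ Gq P *m P = 0 := coZP fr.
have ZB : coZ Gq P *m Bt = 0 := coZB fr.
split; apply: (frame_ext fr).
- by rewrite -mulmxA (elt_P fr) mulmxA ZP mul0mx -mulmxA ZP mulmx0.
- rewrite -mulmxA (elt_B fr) mulmxDr (mulmxA _ P) (mulmxA _ Bt) ZP ZB.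
  by rewrite !mul0mx addr0 -mulmxA ZB mulmx0.
- rewrite -mulmxA (elt_Z fr) 2!(mulmxDr (coZ _ _)).
  rewrite (mulmxA _ P) (mulmxA _ Bt) (mulmxA _ Z D) ZP ZB ZE.
  by rewrite !mul0mx !add0r mul1mx -mulmxA ZE mulmx1.
- rewrite -(mulmxA (coB _ _)) (elt_P fr) (mulmxA _ P) (coBP fr) mul0mx mulmxDl.
  by rewrite -(mulmxA _ (coB _ _)) (coBP fr) -(mulmxA _ (coZ _ _)) ZP !mulmx0 addr0.
- rewrite -(mulmxA (coB _ _)) (elt_B fr) (coB_comb fr) mulmxDl.
  by rewrite -(mulmxA _ (coB _ _)) (coBB fr) -(mulmxA _ (coZ _ _)) ZB mulmx0 mulmx1 addr0.
rewrite -(mulmxA (coB _ _)) (elt_Z fr) (mulmxDr (coB _ _)) (coB_comb fr) (mulmxA _ Z D) (coBZ fr).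
rewrite mul0mx addr0 mulmxDl -(mulmxA _ (coB _ _)) (coBZ fr) mulmx0 add0r.
by rewrite -(mulmxA _ (coZ _ _)) ZE mulmx1.
Qed.

Lemma GammaLI_acts (A : 'M[int]_N) : GammaLI R G z w A ->
  exists M lam mu c, [/\ SLI G z w M, bM_pair G z w zeta ups B M lam mu,
    disc_kernel R (gramLambda G B) c & acts A M c (row_mx lam mu)].
Proof.
move=> LA; have isoA := GammaLI_iso LA; have [M dM AP] := GammaLI_SL2 cd LA.
have [c dc cE] := GammaLI_Lambda cd LA; have [_ [_ _ tA]] := LA.
(* The off-diagonal block is X M^{-*}, so X is recovered by multiplying it with M^T. *)
pose X := coB Gq Bt *m (ofint rat A *m Z) *m (ofint rat M)^T.
exists M, (col 0 X), (col 1 X), c; split=> //.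
- exact: (analysis_SLI cd AP dM tA).
- exact: (analysis_bM cd isoA AP dM tA).
rewrite row_mx_cols.
have uM : M \in unitmx by rewrite unitmxE dM unitr1.
have APq : ofint rat A *m P = P *m ofint rat M by rewrite -!ofintM AP.
have uMq : ofint rat M \in unitmx.
  by rewrite unitmxE /ofint det_map_mx dM rmorph1 unitr1.
have AB := isometry_blocks fr isoA APq uMq.
have AZ := frame_dec fr (ofint rat A *m Z).
have [MD _ _] := blocks_of_isometry fr APq AB AZ isoA.
have MD' : (ofint rat M)^T *m ofint rat (invmx M)^T = 1%:M.
  by rewrite ofint_tr -trmx_mul -ofintM mulVmx// ofint1 trmx1.
have DE : coZ Gq P *m (ofint rat A *m Z) = ofint rat (invmx M)^T.
  have uMt : (ofint rat M)^T \in unitmx by rewrite unitmx_tr.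
  by rewrite -[LHS](mulKmx uMt) MD -MD' mulKmx.
apply: (elt_acts (H := coP Gq P Z *m (ofint rat A *m Bt))
  (J := coP Gq P Z *m (ofint rat A *m Z))).
apply: (frame_ext fr); rewrite ?(elt_P fr) ?(elt_B fr) ?(elt_Z fr)//.
  by rewrite cE.
by rewrite /X -(mulmxA _ _^T) MD' mulmx1 -DE.
Qed.

(** Every representative (lam, mu) of b_M is realized, not just one for each M; this is what makes
    lattice translations available. *)
Lemma SL2_lift (M : 'M[int]_2) (lam mu : 'cV[rat]_m) :
  SLI G z w M -> bM_pair G z w zeta ups B M lam mu ->
  exists2 A, GammaLI R G z w A & acts A M 1%:M (row_mx lam mu).
Proof.
move=> /(SLIP cd)[dM sM] /(bM_pairP cd)[_ bX].
have [J [A [AE uA tA JE]]] := synth_matrix cd dM sM bX.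
exists A; first exact: (synth_GammaLI R cd dM AE uA tA JE).
by apply: elt_acts; rewrite ofint1; exact: AE.
Qed.

Lemma gram_lift (c : 'M[int]_m) : disc_kernel R (gramLambda G B) c ->
  exists2 A, GammaLI R G z w A & acts A 1%:M c 0.
Proof.
move=> /(Lambda_lift cd)[A LA AE]; exists A => //.
apply: (elt_acts (H := 0) (J := 0)).
by rewrite invmx1 trmx1 !ofint1 mul0mx; exact: AE.
Qed.

Definition col2 (tau : C) : 'cV[C]_2 := \col_(i < 2) if i == 0 then 1 else tau.

Definition to_HLambda (xi : 'cV[C]_N) : C^o * 'cV[C]_m :=
  (bilform G xi (ofint C w), coB GC BC *m xi).

Definition of_HLambda (p : C^o * 'cV[C]_m) : 'cV[C]_N :=
  ZC *m col2 p.1 + BC *m p.2.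

Lemma bilform_sym (x y : 'cV[C]_N) : bilform G x y = bilform G y x.
Proof. exact: (bilformC cd). Qed.

Lemma coZ_bilform (xi : 'cV[C]_N) i :
  (coZ GC PC *m xi) i 0 = bilform G xi (if i == 0 then ofint C z else ofint C w).
Proof.
rewrite /coZ bilformE bilform_sym (_ : col 0 xi = xi); last first.
  by apply/matrixP => k l; rewrite ord1 mxE.
by rewrite /ofint map_pair; case: (ord2P i) => ->; rewrite ?col0_pair ?col1_pair.
Qed.

Lemma coZ_col2 (xi : 'cV[C]_N) : bilform G xi (ofint C z) = 1 ->
  coZ GC PC *m xi = col2 (to_HLambda xi).1.
Proof.
move=> xi1; apply/matrixP => i j; rewrite ord1 coZ_bilform mxE.
by case: (i == 0).
Qed.

Lemma to_HLambda_U (xi xi' : 'cV[C]_N) : spaceU z w (xi' - xi) ->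
  bilform G xi' (ofint C z) = bilform G xi (ofint C z) /\
  to_HLambda xi' = to_HLambda xi.
Proof.
move=> [a _ aE]; have -> : xi' = PC *m a + xi by rewrite aE subrK.
have Ze : coZ GC PC *m (PC *m a + xi) = coZ GC PC *m xi.
  by rewrite mulmxDr (mulmxA _ PC) (coZP frC) mul0mx add0r.
split; first by rewrite -(coZ_bilform _ 0) Ze coZ_bilform.
congr pair; first by rewrite -(coZ_bilform _ 1) Ze coZ_bilform.
by rewrite mulmxDr (mulmxA _ PC) (coBP frC) mul0mx add0r.
Qed.

Lemma of_to_HLambda (xi : 'cV[C]_N) : bilform G xi (ofint C z) = 1 ->
  spaceU z w (xi - of_HLambda (to_HLambda xi)).
Proof.
move=> xi1; exists (coP GC PC ZC *m xi) => //.
apply: (canRL (addrK _)); rewrite [RHS](frame_dec frC xi) coZ_col2//.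
by rewrite /of_HLambda addrA addrAC.
Qed.

Lemma to_HLambda_inj_U (xi xi' : 'cV[C]_N) :
  bilform G xi (ofint C z) = 1 -> bilform G xi' (ofint C z) = 1 ->
  to_HLambda xi = to_HLambda xi' -> spaceU z w (xi' - xi).
Proof.
move=> /of_to_HLambda[a _ aE] /of_to_HLambda[b _ bE] e.
exists (b - a) => //; rewrite mulmxBr aE bE e opprB addrA subrK.
by [].
Qed.

Lemma coZ_of_HLambda p : coZ GC PC *m of_HLambda p = col2 p.1.
Proof.
rewrite mulmxDr (mulmxA _ ZC) (mulmxA _ BC) (coZZ frC) (coZB frC).
by rewrite mul1mx mul0mx addr0.
Qed.

Lemma of_HLambda_z p : bilform G (of_HLambda p) (ofint C z) = 1.
Proof. by rewrite -(coZ_bilform _ 0) coZ_of_HLambda mxE. Qed.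

Lemma of_HLambdaK : cancel of_HLambda to_HLambda.
Proof.
move=> [tau x]; congr pair.
  by rewrite -(coZ_bilform _ 1) coZ_of_HLambda mxE.
rewrite /of_HLambda mulmxDr (mulmxA _ ZC) (mulmxA _ BC) (coBZ frC) (coBB frC).
by rewrite mul1mx mul0mx add0r.
Qed.

Lemma row_mx_col2 (lam mu : 'cV[C]_m) (c : 'cV[C]_2) :
  row_mx lam mu *m c = c 0 0 *: lam + c 1 0 *: mu.
Proof. by rewrite basU_mul !mul_mx_scalar. Qed.

Section Pact.
Context (A : 'M[int]_N) (M : 'M[int]_2) (c : 'M[int]_m) (lam mu : 'cV[rat]_m)
  (xi : 'cV[C]_N).
Local Notation tau := (to_HLambda xi).1.
Hypotheses (AM : acts A M c (row_mx lam mu)) (xi1 : bilform G xi (ofint C z) = 1).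

Let coZA : coZ GC PC *m (ofint C A *m xi) = Mdual M tau.
Proof.
have [/(congr1 (map_mx ratr : 'M[rat]_(2, N) -> 'M[C]_(2, N))) e _] := AM.
move: e; rewrite (map_mxM _ (coZ _ _)) (map_mxM _ (ofint _ _^T)) -coZ_map.
rewrite !(ratr_ofint C) => e.
by rewrite mulmxA e -mulmxA coZ_col2.
Qed.

Lemma pact_z : bilform G (ofint C A *m xi) (ofint C z) = jM M tau.
Proof. by rewrite -(coZ_bilform _ 0) coZA. Qed.

(** The normalizing factor (A xi, z) is j(M, tau). The off-diagonal block sends xi to X M^{-*}(1,
    tau), which becomes lam + (M tau) mu after division by j. *)
Lemma pact_coords : jM M tau != 0 ->
  bilform G (pact G z (ofint C A) xi) (ofint C z) = 1 /\
  to_HLambda (pact G z (ofint C A) xi) =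
  (Mtau M tau, (jM M tau)^-1 *: (ofint C c *m (to_HLambda xi).2) +
     (map_mx ratr lam + Mtau M tau *: map_mx ratr mu)).
Proof.
move=> j0; rewrite /pact pact_z.
have Zp : coZ GC PC *m ((jM M tau)^-1 *: (ofint C A *m xi)) =
    (jM M tau)^-1 *: Mdual M tau by rewrite -scalemxAr coZA.
split; first by rewrite -(coZ_bilform _ 0) Zp mxE mulVf.
congr pair; first by rewrite -(coZ_bilform _ 1) Zp mxE mulrC.
have [_ /(congr1 (map_mx ratr : 'M[rat]_(m, N) -> 'M[C]_(m, N))) e] := AM.
move: e; rewrite map_mxD (map_mxM _ (coB _ _)) (map_mxM _ (ofint _ c)).
rewrite (map_mxM _ (row_mx lam mu *m _)) (map_mxM _ (row_mx lam mu)) -coZ_map -coB_map.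
rewrite !(ratr_ofint C) => e.
rewrite -scalemxAr mulmxA e mulmxDl -(mulmxA _ (coB _ _)) -(mulmxA _ (coZ _ _)).
rewrite coZ_col2// -(mulmxA _ _ (col2 _)) -/(Mdual M tau) map_pair row_mx_col2.
rewrite scalerDr; congr (_ + _).
by rewrite scalerDr !scalerA mulVf// scale1r mulrC.
Qed.

End Pact.

End Action.

(** * Differentiability of matrix-valued maps *)

Section MatrixDifferentiability.
Context {K : numFieldType} {E : normedModType K}.

Definition mxdiff p q (f : E -> 'M[K]_(p, q)) :=
  forall i j x, differentiable (fun y => f y i j : K^o) x.

Lemma mxdiff_differentiable p q (f : E -> 'M[K]_(p, q)) :
  mxdiff f -> forall x, differentiable f x.
Proof.
move=> df x.
have -> : f = \sum_(i < p) \sum_(j < q) (fun y => (f y i j : K^o) *: delta_mx i j).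
  apply/funext => y; rewrite fct_sumE [LHS]matrix_sum_delta.
  by apply: eq_bigr => i _; rewrite fct_sumE.
apply: differentiable_sum => i; apply: differentiable_sum => j.
exact: differentiableZl.
Qed.

Lemma mxdiff_cst p q (A : 'M[K]_(p, q)) : mxdiff (fun=> A).
Proof. by move=> i j x; exact: differentiable_cst. Qed.

Lemma mxdiffD p q (f h : E -> 'M[K]_(p, q)) :
  mxdiff f -> mxdiff h -> mxdiff (fun x => f x + h x).
Proof.
move=> df dh i j x; under eq_fun do rewrite mxE.
by apply: differentiableD; [exact: df|exact: dh].
Qed.

Lemma mxdiff_tr p q (f : E -> 'M[K]_(p, q)) : mxdiff f -> mxdiff (fun x => (f x)^T).
Proof. by move=> df i j x; under eq_fun do rewrite mxE; exact: df. Qed.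

Lemma mxdiffM p q r (f : E -> 'M[K]_(p, q)) (h : E -> 'M[K]_(q, r)) :
  mxdiff f -> mxdiff h -> mxdiff (fun x => f x *m h x).
Proof.
move=> df dh i j x.
have -> : (fun y => (f y *m h y) i j) =
    \sum_(k < q) (fun y => (f y i k : K^o) * (h y k j : K^o) : K^o).
  by apply/funext => y; rewrite fct_sumE mxE.
apply: differentiable_sum => k.
by apply: differentiableM; [exact: df|exact: dh].
Qed.

Lemma mxdiffZ p q (k : E -> K^o) (f : E -> 'M[K]_(p, q)) :
  (forall x, differentiable k x) -> mxdiff f -> mxdiff (fun x => k x *: f x).
Proof.
move=> dk df i j x; under eq_fun do rewrite mxE.
by apply: differentiableM; [exact: dk|exact: df].
Qed.

End MatrixDifferentiability.

Lemma mxdiff_id (K : numFieldType) p q : mxdiff (fun A : 'M[K]_(p, q) => A).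
Proof. by move=> i j x; exact: differentiable_coord. Qed.

Lemma differentiable_fst (K : numFieldType) (E E' : normedModType K) (x : E * E') :
  differentiable (fst : E * E' -> E) x.
Proof. by apply: linear_differentiable => y; exact: cvg_fst. Qed.

Lemma differentiable_snd (K : numFieldType) (E E' : normedModType K) (x : E * E') :
  differentiable (snd : E * E' -> E') x.
Proof. by apply: linear_differentiable => y; exact: cvg_snd. Qed.

Lemma mxdiff_snd (K : numFieldType) (E : normedModType K) p q :
  mxdiff (fun x : E * 'M[K]_(p, q) => x.2).
Proof.
move=> i j x; apply: (differentiable_comp (f := snd)
  (g := fun A : 'M[K]_(p, q) => A i j : K^o)); first exact: differentiable_snd.
exact: mxdiff_id.
Qed.

Lemma mul_mx2_col (K : comPzRingType) (a b : 'cV[K]_2) :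
  (a^T *m b) 0 0 = a 0 0 * b 0 0 + a 1 0 * b 1 0.
Proof.
rewrite mxE !big_ord_recl big_ord0 addr0 !mxE.
by congr (a _ _ * b _ _ + a _ _ * b _ _); apply: val_inj.
Qed.

(** * Coordinate maps and lifts as morphisms *)

Section Quotients.
Context (R : realType) (N m : nat) (G : 'M[int]_N) (I : set 'cV[int]_N)
  (z w : 'cV[int]_N) (zeta ups : 'cV[rat]_N) (B : 'M[int]_(N, m)).
Hypothesis cd : cusp_data G I z w zeta ups B.

Local Notation C := (R[i]).
Local Notation Bt := (cuspB G z w zeta ups B).
Local Notation GC := (ofint C G).
Local Notation PC := (ofint C (basU z w)).
Local Notation ZC := (map_mx ratr (cuspZ zeta ups) : 'M[C]_(N, 2)).
Local Notation BC := (map_mx ratr Bt : 'M[C]_(N, m)).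
Let frC : frame GC PC BC ZC := frame_ratr cd C.
Local Notation toH := (@to_HLambda R N m G z w zeta ups B).
Local Notation ofH := (@of_HLambda R N m G z w zeta ups B).
Local Notation formz x := (bilform G x (ofint C z)).
Local Notation formw x := (bilform G x (ofint C w)).

Local Notation X0 := (fsub (@Dhat R N G z w)).
Local Notation Y0 := (fsub (@HLambda R m)).
Local Notation D0 := (fsub (@disc_set R N G z w)).

Definition mk_set (T : Type) (A : set T) x (Ax : A x) : A := SigSub (mem_set Ax).

Lemma toH_HLambda (xi : X0) : HLambda (toH (set_val xi)).
Proof. by have [] := set_valP xi. Qed.

Definition toH_sub (xi : X0) : Y0 := mk_set (toH_HLambda xi).

Lemma ofH_Dhat (p : Y0) : Dhat G z w (ofH (set_val p)).
Proof.
split; first exact: (of_HLambda_z cd).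
rewrite -[formw _]/(toH (ofH (set_val p))).1 (of_HLambdaK cd).
exact: set_valP p.
Qed.

Definition ofH_sub (p : Y0) : X0 := mk_set (ofH_Dhat p).

Lemma toH_subK : cancel ofH_sub toH_sub.
Proof. by move=> p; apply: val_inj; exact: (of_HLambdaK cd). Qed.

(* An isotropic lift: moving along z suffices since (xi, z) = 1. *)
Definition isoH (p : C^o * 'cV[C]_m) : 'cV[C]_N :=
  ofH p + (- (2^-1 * bilform G (ofH p) (ofH p))) *: ofint C z.

Lemma ofint_z : ofint C z = PC *m delta_mx 0 0.
Proof. by rewrite -colE /ofint map_pair col0_pair. Qed.

Lemma isoH_U p : spaceU z w (isoH p - ofH p).
Proof.
rewrite /isoH addrAC subrr add0r ofint_z scalemxAr.
by exists (- (2^-1 * bilform G (ofH p) (ofH p)) *: delta_mx 0 0).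
Qed.

Lemma toH_isoH p : formz (isoH p) = 1 /\ toH (isoH p) = p.
Proof.
have [-> ->] := to_HLambda_U cd (isoH_U p).
by rewrite (of_HLambda_z cd) (of_HLambdaK cd).
Qed.

Lemma bilform_translate (x : 'cV[C]_N) (a : 'cV[C]_2) :
  bilform G (x + PC *m a) (x + PC *m a) =
  bilform G x x + 2 * (a 0 0 * formz x + a 1 0 * formw x).
Proof.
have e (y : 'cV[C]_N) : bilform G (PC *m a) y =
    a 0 0 * formz y + a 1 0 * formw y.
  rewrite {1}/bilform trmx_mul -!mulmxA (mulmxA PC^T) -/(coZ GC PC).
  rewrite (mul_mx2_col a) !(coZ_bilform cd).
  by [].
have Pz (b : 'cV[C]_2) : bilform G (PC *m a) (PC *m b) = 0.
  by rewrite /bilform (form_coord GC) (frame_PP frC) mulmx0 mul0mx mxE.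
have DE (x1 x2 y : 'cV[C]_N) :
    bilform G (x1 + x2) y = bilform G x1 y + bilform G x2 y.
  by rewrite /bilform trmx_add !mulmxDl mxE.
rewrite DE (bilform_sym cd x) (bilform_sym cd (PC *m a)) !DE Pz.
by rewrite (bilform_sym cd x (PC *m a)) e; ring.
Qed.

Lemma isoH_isotropic p : bilform G (isoH p) (isoH p) = 0.
Proof.
rewrite /isoH ofint_z scalemxAr bilform_translate !mxE /= (of_HLambda_z cd).
by rewrite mulr0 mulr1 mul0r addr0; field.
Qed.

Lemma isoH_disc (p : Y0) :
  disc_set G z w ((isoH (set_val p), 0) : 'cV[C]_N * C^o).
Proof.
have [z1 e] := toH_isoH (set_val p).
split; last by left.
split=> //=; first exact: isoH_isotropic.
rewrite -[formw _]/(toH (isoH (set_val p))).1 e.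
exact: set_valP p.
Qed.

Definition isoH_sub (p : Y0) : D0 := mk_set (isoH_disc p).

Lemma disc_Dhat (p : D0) : Dhat G z w (set_val p).1.
Proof. by have [[_ z1 w0] _] := set_valP p. Qed.

Definition disc_sub (p : D0) : X0 := mk_set (disc_Dhat p).

Lemma mxdiff_bilform (E : normedModType C) (f h : E -> 'cV[C]_N) :
  mxdiff f -> mxdiff h -> forall x, differentiable (fun y => bilform G (f y) (h y) : C^o) x.
Proof.
move=> df dh; apply: (mxdiffM (mxdiffM (mxdiff_tr df) (mxdiff_cst GC)) dh).
Qed.

Lemma toH_sub_fmor : fmor toH_sub.
Proof.
apply: fmor_fsub; first exact: flocal_fsub_fvect.
have : fmor (toH : fvect 'cV[C]_N -> fvect (C^o * 'cV[C]_m)%type).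
  apply: fmor_fvect => x; apply: differentiable_pair.
    by apply: mxdiff_bilform; [exact: mxdiff_id|exact: mxdiff_cst].
  apply: mxdiff_differentiable; apply: mxdiffM; first exact: mxdiff_cst.
  exact: mxdiff_id.
by move=> /(fmor_comp (fsub_val_fmor (@Dhat R N G z w))).
Qed.

Lemma mxdiff_ofH : mxdiff (ofH : C^o * 'cV[C]_m -> 'cV[C]_N).
Proof.
apply: mxdiffD.
  apply: mxdiffM; first exact: mxdiff_cst.
  move=> i j x; case: (ord2P i) => ->; under eq_fun do rewrite mxE /=.
    exact: differentiable_cst.
  exact: differentiable_fst.
apply: mxdiffM; first exact: mxdiff_cst.
exact: mxdiff_snd.
Qed.

Lemma ofH_sub_fmor : fmor ofH_sub.
Proof.
apply: fmor_fsub; first exact: flocal_fsub_fvect.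
have : fmor (ofH : fvect (C^o * 'cV[C]_m)%type -> fvect 'cV[C]_N).
  by apply: fmor_fvect; apply: mxdiff_differentiable; exact: mxdiff_ofH.
by move=> /(fmor_comp (fsub_val_fmor (@HLambda R m))).
Qed.

Lemma isoH_sub_fmor : fmor isoH_sub.
Proof.
apply: fmor_fsub; first exact: flocal_fsub_fvect.
have : fmor ((fun p => (isoH p, 0)) :
    fvect (C^o * 'cV[C]_m)%type -> fvect ('cV[C]_N * C^o)%type).
  apply: fmor_fvect => x; apply: differentiable_pair.
    apply: mxdiff_differentiable; apply: mxdiffD; first exact: mxdiff_ofH.
    apply: mxdiffZ; last exact: mxdiff_cst.
    move=> y; apply: differentiableN; apply: differentiableM.
      exact: differentiable_cst.
    by apply: mxdiff_bilform; exact: mxdiff_ofH.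
  exact: differentiable_cst.
by move=> /(fmor_comp (fsub_val_fmor (@HLambda R m))).
Qed.

Lemma disc_sub_fmor : fmor disc_sub.
Proof.
apply: fmor_fsub; first exact: flocal_fsub_fvect.
have : fmor (fst : fvect ('cV[C]_N * C^o)%type -> fvect 'cV[C]_N).
  by apply: fmor_fvect => x; exact: differentiable_fst.
by move=> /(fmor_comp (fsub_val_fmor (@disc_set R N G z w))).
Qed.

End Quotients.

(** * The isomorphisms *)

Section Isomorphisms.
Context (R : realType) (N m : nat) (G : 'M[int]_N) (I : set 'cV[int]_N)
  (z w : 'cV[int]_N) (zeta ups : 'cV[rat]_N) (B : 'M[int]_(N, m)).
Hypothesis cd : cusp_data G I z w zeta ups B.

Local Notation C := (R[i]).
Local Notation Bt := (cuspB G z w zeta ups B).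
Local Notation GC := (ofint C G).
Local Notation PC := (ofint C (basU z w)).
Local Notation ZC := (map_mx ratr (cuspZ zeta ups) : 'M[C]_(N, 2)).
Local Notation BC := (map_mx ratr Bt : 'M[C]_(N, m)).
Let frC : frame GC PC BC ZC := frame_ratr cd C.
Local Notation toH := (@to_HLambda R N m G z w zeta ups B).
Local Notation ofH := (@of_HLambda R N m G z w zeta ups B).
Local Notation formz x := (bilform G x (ofint C z)).
Local Notation formw x := (bilform G x (ofint C w)).
Local Notation X0 := (fsub (@Dhat R N G z w)).
Local Notation Y0 := (fsub (@HLambda R m)).
Local Notation D0 := (fsub (@disc_set R N G z w)).
Local Notation toHs := (@toH_sub R N m G z w zeta ups B).
Local Notation ofHs := (@ofH_sub R _ _ _ _ _ _ _ _ _ cd).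
Local Notation isoHs := (@isoH_sub R _ _ _ _ _ _ _ _ _ cd).
Local Notation pactA A x := (pact G z (ofint C A) x).

Definition pX (x : X0) : Dtilde_quo R G z w :=
  @fproj R (Dtilde R G z w) _ (@fproj R X0 _ x).

Definition pY (p : Y0) : WLb_quo R G z w zeta ups B :=
  @fproj R (WLb R G z w zeta ups B) _ (@fproj R (ELambda R m) _ (@fproj R Y0 _ p)).

Definition pD (p : D0) : disc_bundle_quo R G z w :=
  @fproj R (disc_bundle R G z w) _ (@fproj R D0 _ p).

Lemma pX_eqU (p q : X0) : spaceU z w (set_val q - set_val p) -> pX p = pX q.
Proof.
move=> pq; have e : @fproj R X0 _ p = @fproj R X0 _ q :> Dtilde R G z w.
  by apply: fproj_eq; exact: pq.
exact: (f_equal (fun t : Dtilde R G z w => @fproj R (Dtilde R G z w) _ t) e).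
Qed.

Lemma pD_eqS (p q : D0) (S : 'M[C]_2) : antisym_mx S ->
  (set_val q).1 = unip G z w S *m (set_val p).1 ->
  (set_val p).2 = expi2pi (S 1 0) * (set_val q).2 -> pD p = pD q.
Proof.
move=> aS q1 q2.
have e : @fproj R D0 _ p = @fproj R D0 _ q :> disc_bundle R G z w.
  by apply: fproj_eq; exists S; split; [exact: aS|exact: q1|exact: q2].
exact: (f_equal (fun t : disc_bundle R G z w => @fproj R (disc_bundle R G z w) _ t) e).
Qed.

Lemma pX_eqA (p q : X0) (A : 'M[int]_N) : GammaLI R G z w A ->
  set_val q = pactA A (set_val p) -> pX p = pX q.
Proof.
move=> LA qE; apply: fproj_eq; exists p, q.
split; [exact: erefl|exact: erefl|].
exists (ofint rat A); last by rewrite ratr_ofint.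
exists [set ofint rat A *m unip G z w S | S in antisym_mx (K := rat)].
  by exists A.
exists 0; first by rewrite /antisym_mx /= trmx0 oppr0.
by rewrite /unip mulmx0 !mul0mx subr0 mulmx1.
Qed.

Lemma pD_eqA (p q : D0) (A : 'M[int]_N) : GammaLI R G z w A ->
  (set_val q).1 = pactA A (set_val p).1 -> (set_val q).2 = (set_val p).2 ->
  pD p = pD q.
Proof.
move=> LA q1 q2; apply: fproj_eq; exists p, q.
by split; [exact: erefl|exact: erefl|exists A; [exact: LA|split]].
Qed.

Lemma pY_eqSL2 (p q : Y0) M lam mu : SLI G z w M ->
  bM_pair G z w zeta ups B M lam mu ->
  (set_val q).1 = Mtau M (set_val p).1 ->
  (set_val q).2 = (jM M (set_val p).1)^-1 *: (set_val p).2 +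
    (map_mx ratr lam + Mtau M (set_val p).1 *: map_mx ratr mu) ->
  pY p = pY q.
Proof.
move=> sM bM q1 q2.
have e : @fproj R (ELambda R m) _ (@fproj R Y0 _ p) =
    @fproj R (ELambda R m) _ (@fproj R Y0 _ q) :> WLb R G z w zeta ups B.
  apply: fproj_eq; exists p, q; split; [exact: erefl|exact: erefl|].
  by exists M, lam, mu; split; [exact: sM|exact: bM|exact: q1|exact: q2].
exact: (f_equal (fun t : WLb R G z w zeta ups B =>
  @fproj R (WLb R G z w zeta ups B) _ t) e).
Qed.

Lemma pY_eq_gram (p q : Y0) c : disc_kernel R (gramLambda G B) c ->
  (set_val q).1 = (set_val p).1 ->
  (set_val q).2 = ofint C c *m (set_val p).2 -> pY p = pY q.
Proof.
move=> dc q1 q2; apply: fproj_eq; exists p, q.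
by split; [exact: erefl|exact: erefl|exists c; [exact: dc|split]].
Qed.

Lemma unip_coZ (S : 'M[C]_2) (x : 'cV[C]_N) :
  unip G z w S *m x = x - PC *m (S *m (coZ GC PC *m x)).
Proof. by rewrite /unip mulmxBl mul1mx !mulmxA. Qed.

Lemma unip_U (S : 'M[C]_2) (x : 'cV[C]_N) : spaceU z w (unip G z w S *m x - x).
Proof.
rewrite unip_coZ addrAC subrr add0r -mulmxN.
by exists (- (S *m (coZ GC PC *m x))).
Qed.

Lemma unip_ratr (S : 'M[rat]_2) :
  map_mx ratr (unip G z w S) = unip G z w (map_mx ratr S) :> 'M[C]_N.
Proof.
by rewrite /unip map_mxB map_mx1 !map_mxM -map_trmx !ratr_ofint.
Qed.

(** A translate x + P a of an isotropic x is isotropic iff a is orthogonal to (1, tau), that is, a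
    is a multiple of (- tau, 1). This multiple is the effect of an antisymmetric S. *)
Lemma isotropic_unip (x y : 'cV[C]_N) : formz x = 1 -> bilform G x x = 0 ->
  bilform G y y = 0 -> spaceU z w (y - x) ->
  exists2 S, antisym_mx S & y = unip G z w S *m x.
Proof.
move=> x1 xx yy [a _ aE]; have yE : y = x + PC *m a by rewrite aE addrC subrK.
move: yy; rewrite yE (bilform_translate cd) xx x1 mulr1 add0r => /eqP.
rewrite mulf_eq0 pnatr_eq0 /= addr_eq0 => /eqP a0.
exists (a 1 0 *: symp2).
  by apply: mx2P; rewrite /symp2 !mxE /=; ring.
rewrite unip_coZ (coZ_col2 cd x1) -mulmxN; congr (_ + _ *m _).
apply/matrixP => i j; rewrite ord1 mxE mxE !big_ord_recl big_ord0 addr0.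
by case: (ord2P i) => ->; rewrite ?a0 /symp2 !mxE /=; ring.
Qed.

(** Some A maps every lift of p to a lift of q. Quantifying over all lifts lets one relation serve
    both for the lifts in the affine bundle and for the isotropic lifts in the disc bundle. *)
Definition yrel (p q : Y0) := exists2 A, GammaLI R G z w A &
  forall xi, formz xi = 1 -> toH xi = set_val p ->
    formz (pactA A xi) = 1 /\ toH (pactA A xi) = set_val q.

Lemma jM_neq0 M (q : Y0) tau : (set_val q).1 = Mtau M tau -> jM M tau != 0.
Proof.
move=> qE; have := set_valP q; rewrite /HLambda /= qE /Mtau.
(* If j were zero, division by it would give [Mtau] the value 0, which is not in the upper
   half-plane. *)
by apply: contraTneq => ->; rewrite invr0 mulr0 ltxx.
Qed.

Lemma yrel_SL2 (p q : Y0) M lam mu : SLI G z w M ->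
  bM_pair G z w zeta ups B M lam mu ->
  (set_val q).1 = Mtau M (set_val p).1 ->
  (set_val q).2 = (jM M (set_val p).1)^-1 *: (set_val p).2 +
    (map_mx ratr lam + Mtau M (set_val p).1 *: map_mx ratr mu) ->
  yrel p q.
Proof.
move=> sM bM q1 q2; have [A LA aA] := SL2_lift R cd sM bM.
exists A => // xi xi1 xip; have j0 := jM_neq0 q1.
have := pact_coords cd aA xi1; rewrite xip ofint1 mul1mx => /(_ j0)[-> ->].
by split=> //; rewrite -q2 -q1; case: (set_val q).
Qed.

Lemma Mdual1 (tau : C) : Mdual 1%:M tau = col2 tau.
Proof. by rewrite /Mdual invmx1 trmx1 ofint1 mul1mx. Qed.

Lemma jM1 (tau : C) : jM 1%:M tau = 1.
Proof. by rewrite /jM Mdual1 mxE. Qed.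

Lemma Mtau1 (tau : C) : Mtau 1%:M tau = tau.
Proof. by rewrite /Mtau jM1 Mdual1 mxE divr1. Qed.

Lemma yrel_translation (p q : Y0) (l l' : 'cV[int]_m) :
  (set_val q).1 = (set_val p).1 ->
  (set_val q).2 = (set_val p).2 +
    (ofint C l + ((set_val p).1 : C) *: ofint C l') -> yrel p q.
Proof.
move=> q1 q2; apply: (@yrel_SL2 p q 1%:M (ofint rat l) (ofint rat l')).
- apply/(SLIP cd); rewrite det1; split=> // a _.
  rewrite ofint1 mul1mx subrr.
  by apply/mxOverP => i j; rewrite mxE.
- have iX : mxint (row_mx (ofint rat l) (ofint rat l') : 'M[rat]_(m, 2)).
    by apply: mxint_cols => j; case: (ord2P j) => ->;
      rewrite ?col0_pair ?col1_pair ofint_mxint.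
  apply/(bM_pairP cd); split; first exact: mxintM (mxint_tr iX) (ofint_mxint _).
  move=> d id; have [a da] := dual_lift cd id; exists a => //.
  rewrite ofint1 mul1mx subrr subr0 -mulmxA; apply: mxintM (mxint_tr iX) _.
  by rewrite -(gram_sym cd) -[d]trmxK -trmx_mul; exact: mxint_tr.
- by rewrite Mtau1.
by rewrite jM1 Mtau1 invr1 scale1r !ratr_ofint.
Qed.

Lemma yrel_gram (p q : Y0) c : disc_kernel R (gramLambda G B) c ->
  (set_val q).1 = (set_val p).1 ->
  (set_val q).2 = ofint C c *m (set_val p).2 -> yrel p q.
Proof.
move=> dc q1 q2; have [A LA aA] := gram_lift cd dc.
exists A => // xi xi1 xip.
(* The zero block is read as the pair lam = mu = 0. *)
rewrite -(@row_mx0 _ m 1 1) in aA.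
have := pact_coords cd aA xi1; rewrite xip jM1 Mtau1 invr1 scale1r.
move=> /(_ (oner_neq0 _))[-> ->]; rewrite map_mx0 scaler0 !addr0; split=> //.
by rewrite -q2 -q1; case: (set_val q).
Qed.

(** All three generating relations, the lattice translations, the action of SL(I_{L^*}, I) and that
    of Gamma_Lambda, are instances of [yrel]. *)
Lemma WLb_lift (T : fspace R) (phi : Y0 -> T) : fmor phi ->
  (forall p q, yrel p q -> phi p = phi q) ->
  exists2 psi : WLb_quo R G z w zeta ups B -> T,
    fmor psi & forall p, psi (pY p) = phi p.
Proof.
move=> mphi inv.
have [psi1 m1 e1] : exists2 psi1 : ELambda R m -> T,
    fmor psi1 & forall p, psi1 (@fproj R Y0 _ p) = phi p.
  apply: fquo_lift => // p q [q1 [l [l' q2]]].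
  by apply: inv; exact: yrel_translation q1 q2.
have [psi2 m2 e2] : exists2 psi2 : WLb R G z w zeta ups B -> T,
    fmor psi2 & forall p, psi2 (@fproj R (ELambda R m) _ p) = psi1 p.
  apply: fquo_lift => // _ _ [p [q [-> -> [M [lam [mu [sM bM q1 q2]]]]]]].
  by rewrite !e1; apply: inv; exact: yrel_SL2 sM bM q1 q2.
have [psi3 m3 e3] : exists2 psi3 : WLb_quo R G z w zeta ups B -> T,
    fmor psi3 & forall p, psi3 (@fproj R (WLb R G z w zeta ups B) _ p) = psi2 p.
  apply: fquo_lift => // _ _ [p [q [-> -> [c dc [q1 q2]]]]].
  by rewrite !e2 !e1; apply: inv; exact: yrel_gram dc q1 q2.
by exists psi3 => // p; rewrite /pY e3 e2 e1.
Qed.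

Lemma pY_fmor : fmor pY.
Proof.
have m1 : fmor (@fproj R Y0 _ : Y0 -> ELambda R m) by exact: fproj_fmor.
have m2 : fmor (@fproj R (ELambda R m) _ : _ -> WLb R G z w zeta ups B).
  exact: fproj_fmor.
have m3 : fmor (@fproj R (WLb R G z w zeta ups B) _ :
    _ -> WLb_quo R G z w zeta ups B) by exact: fproj_fmor.
exact: fmor_comp (fmor_comp m1 m2) m3.
Qed.

Lemma pX_fmor : fmor pX.
Proof.
have m1 : fmor (@fproj R X0 _ : X0 -> Dtilde R G z w) by exact: fproj_fmor.
have m2 : fmor (@fproj R (Dtilde R G z w) _ : _ -> Dtilde_quo R G z w).
  exact: fproj_fmor.
exact: fmor_comp m1 m2.
Qed.

Lemma pD_fmor : fmor pD.
Proof.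
have m1 : fmor (@fproj R D0 _ : D0 -> disc_bundle R G z w) by exact: fproj_fmor.
have m2 : fmor (@fproj R (disc_bundle R G z w) _ : _ -> disc_bundle_quo R G z w).
  exact: fproj_fmor.
exact: fmor_comp m1 m2.
Qed.

Lemma pX_surj x : exists p, x = pX p.
Proof.
by have [x1 ->] := fproj_surj x; have [p ->] := fproj_surj x1; exists p.
Qed.

Lemma pY_surj y : exists p, y = pY p.
Proof.
have [y1 ->] := fproj_surj y; have [y2 ->] := fproj_surj y1.
by have [p ->] := fproj_surj y2; exists p.
Qed.

(** The action of A factors through an element of Gamma_Lambda followed by the action of M with a
    representative of b_M. The freedom to move xi by U absorbs a unipotent factor of A. *)
Lemma pY_pact (A : 'M[int]_N) (p q : X0) (xi : 'cV[C]_N) :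
  GammaLI R G z w A -> spaceU z w (xi - set_val p) ->
  set_val q = pactA A xi -> pY (toHs p) = pY (toHs q).
Proof.
move=> LA /(to_HLambda_U cd)[xi1 xiE] qE.
have p1 : formz (set_val p) = 1 by have [] := set_valP p.
have q1 : formz (set_val q) = 1 by have [] := set_valP q.
rewrite p1 in xi1.
have [M [lam [mu [c [sM bM dc aA]]]]] := GammaLI_acts cd LA.
(* With j = 0 the normalized image would be the zero vector, which does not pair to 1 with z. *)
have j0 : jM M (toH xi).1 != 0.
  apply/eqP => j0; move: q1; rewrite qE /pact (pact_z cd aA xi1) j0 invr0 scale0r.
  by rewrite /bilform trmx0 !mul0mx mxE => /esym/eqP; rewrite oner_eq0.
have [_ qH] := pact_coords cd aA xi1 j0.
have p2H : HLambda (((toH xi).1, ofint C c *m (toH xi).2) : C^o * 'cV[C]_m).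
  by have := toH_HLambda zeta ups B p; rewrite -xiE.
pose p2 : Y0 := mk_set p2H.
have pv : set_val (toHs p) = toH xi by rewrite xiE.
have qv : set_val (toHs q) = toH (set_val q) := erefl.
transitivity (pY p2).
  by apply: (pY_eq_gram dc); rewrite pv; exact: erefl.
by apply: (pY_eqSL2 sM bM); rewrite qv qE qH.
Qed.

Lemma Dtilde_lift (T : fspace R) (phi : X0 -> T) : fmor phi ->
  (forall p q : X0, spaceU z w (set_val q - set_val p) -> phi p = phi q) ->
  (forall p q : X0, (exists2 A : 'M[rat]_N,
      (exists2 cA, GammaLI_bar R G z w cA & cA A) &
      set_val q = pact G z (map_mx ratr A) (set_val p)) -> phi p = phi q) ->
  exists2 psi : Dtilde_quo R G z w -> T, fmor psi & forall p, psi (pX p) = phi p.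
Proof.
move=> mphi invU invA.
have [psi1 m1 e1] : exists2 psi1 : Dtilde R G z w -> T,
    fmor psi1 & forall p, psi1 (@fproj R X0 _ p) = phi p by exact: fquo_lift.
have [psi2 m2 e2] : exists2 psi2 : Dtilde_quo R G z w -> T,
    fmor psi2 & forall p, psi2 (@fproj R (Dtilde R G z w) _ p) = psi1 p.
  by apply: fquo_lift => // _ _ [p [q [-> -> /invA pq]]]; rewrite !e1.
by exists psi2 => // p; rewrite /pX e2 e1.
Qed.

Lemma Dtilde_iso : fiso (Dtilde_quo R G z w) (WLb_quo R G z w zeta ups B).
Proof.
have [|p q pq|p q|f mf fE] := @Dtilde_lift _ (pY \o toHs).
- exact: fmor_comp (toH_sub_fmor R _ _ _ _ _ _) pY_fmor.
- have [_ e] := to_HLambda_U cd pq; apply: (congr1 pY).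
  by apply: val_inj; exact: esym e.
- move=> [_ [_ [A LA <-] [S _ <-]] qE].
  apply: (pY_pact LA (xi := unip G z w (map_mx ratr S) *m set_val p)).
    exact: unip_U.
  by rewrite qE map_mxM ratr_ofint unip_ratr /pact mulmxA.
have [|p q [A LA pA]|g mg gE] := @WLb_lift _ (pX \o ofHs).
- exact: fmor_comp (ofH_sub_fmor R cd) pX_fmor.
- have [y1 yH] := pA _ (of_HLambda_z cd _) (of_HLambdaK cd _).
  have yD : Dhat G z w (pactA A (ofH (set_val p))).
    split=> //; rewrite -[formw _]/(toH _).1 yH.
    exact: set_valP q.
  (* The image of the chosen lift of p is some lift of q; it agrees with the chosen one modulo U. *)
  transitivity (pX (mk_set yD)); first exact: (pX_eqA LA).
  apply: pX_eqU; apply: (to_HLambda_inj_U cd y1 (of_HLambda_z cd _)).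
  by rewrite yH (of_HLambdaK cd).
have {}fE p : f (pX p) = pY (toHs p) := fE p.
have {}gE p : g (pY p) = pX (ofHs p) := gE p.
apply: (fiso_of_fmor _ _ mf mg).
  move=> x; have [xi ->] := pX_surj x; rewrite fE gE; apply: pX_eqU.
  apply: (of_to_HLambda cd).
  by have [] := set_valP xi.
by move=> y; have [p ->] := pY_surj y; rewrite gE fE toH_subK.
Qed.

Lemma pact_form (A : 'M[int]_N) (x : 'cV[C]_N) : GammaLI R G z w A ->
  bilform G x x = 0 -> bilform G (pactA A x) (pactA A x) = 0.
Proof.
move=> LA xx; have isoA : (ofint C A)^T *m GC *m ofint C A = GC.
  by rewrite -!(ratr_ofint C) map_trmx -!map_mxM (GammaLI_iso LA).
rewrite /pact; set k := _^-1.
suff -> : bilform G (k *: (ofint C A *m x)) (k *: (ofint C A *m x)) =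
    k * k * bilform G x x by rewrite xx mulr0.
rewrite {1}/bilform [(k *: _)^T]linearZ /= -!scalemxAl -scalemxAr scalerA mxE.
by rewrite (form_coord GC) isoA.
Qed.

Lemma pD_unip (p q : D0) : (set_val p).2 = 0 -> (set_val q).2 = 0 ->
  toH (set_val p).1 = toH (set_val q).1 -> pD p = pD q.
Proof.
move=> p0 q0 pq.
have [[pp pz _] _] : disc_set G z w (set_val p) := set_valP p.
have [[qq qz _] _] : disc_set G z w (set_val q) := set_valP q.
have [S aS qE] := isotropic_unip pz pp qq (to_HLambda_inj_U cd pz qz pq).
by apply: (pD_eqS aS qE); rewrite p0 q0 mulr0.
Qed.

Lemma disc_bundle_lift (T : fspace R) (phi : D0 -> T) : fmor phi ->
  (forall p q : D0, (exists S, [/\ antisym_mx S,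
      (set_val q).1 = unip G z w S *m (set_val p).1 &
      (set_val p).2 = expi2pi (S 1 0) * (set_val q).2]) -> phi p = phi q) ->
  (forall p q : D0, (exists2 A, GammaLI R G z w A &
      (set_val q).1 = pactA A (set_val p).1 /\ (set_val q).2 = (set_val p).2) ->
    phi p = phi q) ->
  exists2 psi : disc_bundle_quo R G z w -> T,
    fmor psi & forall p, psi (pD p) = phi p.
Proof.
move=> mphi invS invA.
have [psi1 m1 e1] : exists2 psi1 : disc_bundle R G z w -> T,
    fmor psi1 & forall p, psi1 (@fproj R D0 _ p) = phi p by exact: fquo_lift.
have [psi2 m2 e2] : exists2 psi2 : disc_bundle_quo R G z w -> T,
    fmor psi2 & forall p, psi2 (@fproj R (disc_bundle R G z w) _ p) = psi1 p.
  by apply: fquo_lift => // _ _ [p [q [-> -> /invA pq]]]; rewrite !e1.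
by exists psi2 => // p; rewrite /pD e2 e1.
Qed.

(** One map forgets the fibre coordinate and is defined on the whole disc bundle before being
    restricted to the zero section; the other takes the isotropic lift with fibre coordinate 0. On
    the zero section the factor e(s) has no effect, so all isotropic lifts of a point are
    identified. *)
Lemma toroidal_iso :
  fiso (toroidal_boundary R G z w) (WLb_quo R G z w zeta ups B).
Proof.
have [|p q [S [_ qE _]]|p q [A LA [qE _]]|f mf fE] :=
    @disc_bundle_lift _ (pY \o toHs \o @disc_sub R N G z w).
- apply: fmor_comp pY_fmor; apply: fmor_comp (toH_sub_fmor R _ _ _ _ _ _).
  exact: disc_sub_fmor.
- apply: (congr1 pY); apply: val_inj.
  have [_ e] := to_HLambda_U cd (unip_U S (set_val p).1).
  by rewrite -qE in e; exact: esym e.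
- apply: (pY_pact (xi := (set_val p).1) LA); last exact: qE.
  by exists 0; rewrite // mulmx0 subrr.
pose bd := [set b | exists2 p : D0, (set_val p).2 = 0 & b = pD p].
have bdP (p : Y0) : bd (pD (isoHs p)) by exists (isoHs p).
pose sig (p : Y0) : toroidal_boundary R G z w := mk_set (bdP p).
have msig : fmor sig.
  apply: fmor_fsub; first exact: flocal_fsub_fvect.
  exact: fmor_comp (isoH_sub_fmor R cd) pD_fmor.
have [p q [A LA pA]|g mg gE] := WLb_lift msig.
  apply: val_inj; rewrite -[LHS]/(pD (isoHs p)) -[RHS]/(pD (isoHs q)).
  have [iz iH] := toH_isoH cd (set_val p); have [y1 yH] := pA _ iz iH.
  (* The image of an isotropic lift under A is again isotropic, hence a point of the zero section,
     though not necessarily the chosen lift of q. *)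
  have yD : disc_set G z w ((pactA A (isoH G z w zeta ups B (set_val p)), 0) :
      'cV[C]_N * C^o).
    split; last by left.
    split=> //; first exact: pact_form LA (isoH_isotropic cd _).
    rewrite -[formw _]/(toH _).1 yH.
    exact: set_valP q.
  transitivity (pD (mk_set yD)); first exact: (pD_eqA LA).
  apply: pD_unip; [exact: erefl|exact: erefl|].
  have [_ qH] := toH_isoH cd (set_val q); rewrite -[RHS]/(toH (isoH _ _ _ _ _ _ _)).
  by rewrite qH -yH.
have {}fE p : f (pD p) = pY (toHs (disc_sub p)) := fE p.
have {}gE p : g (pY p) = sig p := gE p.
pose f1 (b : toroidal_boundary R G z w) : WLb_quo R G z w zeta ups B :=
  f (set_val b : disc_bundle_quo R G z w).
have mf1 : fmor f1.
  exact: fmor_comp (fsub_val_fmor (bd : set (disc_bundle_quo R G z w))) mf.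
apply: (fiso_of_fmor _ _ mf1 mg).
- move=> [b bb]; apply: val_inj; have [p p0 bE] := set_mem bb.
  rewrite -[LHS]/(set_val (g (f b))) -[RHS]/b bE fE gE.
  apply: pD_unip; [exact: erefl|exact: p0|].
  exact: (toH_isoH cd (toH (set_val p).1)).2.
move=> y; have [p ->] := pY_surj y; rewrite gE.
rewrite -[LHS]/(f (pD (isoHs p))) fE; apply: (congr1 pY).
by apply: val_inj; exact: (toH_isoH cd (set_val p)).2.
Qed.

End Isomorphisms.

Lemma signature_unit (R : realType) N (G : 'M[int]_N) p q :
  has_signature R G p q -> ofint rat G \in unitmx.
Proof.
move=> [_ [S uS SE]].
have : \det (ofint R G) != 0.
  apply/eqP => d0; have := congr1 determinant SE.
  rewrite !det_mulmx d0 mulr0 mul0r det_diag => /esym/eqP.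
  by apply/negP/prodf_neq0 => i _; rewrite mxE; case: ifP; rewrite ?oppr_eq0 oner_eq0.
by rewrite unitmxE unitfE /ofint !det_map_mx !intr_eq0.
Qed.

Theorem theorem4p5 (R : realType) (n m : nat) (G : 'M[int]_n.+2)
    (I : set 'cV[int]_n.+2) (z w : 'cV[int]_n.+2)
    (zeta ups : 'cV[rat]_n.+2) (B : 'M[int]_(n.+2, m)) :
  even_lattice G -> has_signature R G n 2 ->
  isotropic_sublattice G I -> primitive_sublattice I -> Zbasis I z w ->
  dual_lat G zeta -> dual_lat G ups ->
  bilform G zeta (ofint rat z) = 1 -> bilform G zeta (ofint rat w) = 0 ->
  bilform G ups (ofint rat z) = 0 -> bilform G ups (ofint rat w) = 1 ->
  Lambda_basis G I B ->
  fiso (Dtilde_quo R G z w) (WLb_quo R G z w zeta ups B) /\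
  fiso (toroidal_boundary R G z w) (WLb_quo R G z w zeta ups B).
Proof.
move=> evenG sigG isoI _ basI dzeta dups zz zw uz uw basB.
have cd : cusp_data G I z w zeta ups B.
  by split=> //; exact: signature_unit sigG.
by split; [exact: (Dtilde_iso R cd)|exact: (toroidal_iso R cd)].
Qed.
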